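(* Let $(X,Y)$ have joint distribution $\pi$ on $\mathbb{R}^d\times[k]$, let $g:\mathbb{R}^d\to\Delta^{k-1}$ be a predictor with associated classification function $c(X)\in[k]$ and confidence function $h(X)\in[0,1]$ (both functions of $g(X)$), and let $(x_i,y_i)_{i\ge1}$ be i.i.d. samples from $\pi$. Let $\varphi:[0,1]\to\overline{\mathbb{R}}$ be $C^1$ and strictly convex. Let $K:\mathbb{R}\to\mathbb{R}$ be a kernel such that (1) $K(x)\in[0,K^*]$ for all $x$, for some $K^*<\infty$; (2) $K(x)=L(|x|)$ for some nonincreasing function $L$; (3) $\lim_{u\to\infty}uL(u)=0$; (4) $L(u^* )>0$ for some $u^*>0$. Let $\sigma_n>0$ be bandwidths with $\sigma_n\to0$ and $n\sigma_n^2/\log n\to\infty$. Define the plugin estimator $$\hat d_{\varphi,n}=\frac1n\sum_{i=1}^n\Big[\varphi\big(\hat m_{\sigma_n}(h(x_i))\big)-\varphi\big(h(x_i)\big)-\varphi'\big(h(x_i)\big)\big(\mathbf{1}_{y_i=c(x_i)}-h(x_i)\big)\Big],$$ where $\hat m_{\sigma_n}$ is the kernel regression estimator of $\mathbb{E}[\mathbf{1}_{Y=c(X)}\mid h(X)=\cdot\,]$ built from the first $n$ samples. Suppose in addition that $\mathbb{E}[\mathbf{1}_{Y=c(X)}\mid h(X)=t]$ is continuous in $t$ and that $h(X)$ has a density bounded away from zero. Then $$\hat d_{\varphi,n}\;\to\;\mathbb{E}\Big[d_\varphi\big(\mathbb{E}[\mathbf{1}_{Y=c(X)}\mid h(X)],\,h(X)\big)\Big]\quad\text{in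 probability as } n\to\infty.$$
   Context: $[k]=\{1,\dots,k\}$; $\Delta^{k-1}$ is the probability simplex in $\mathbb{R}^k$; $\overline{\mathbb{R}}$ is the extended real line. $c(X)$ and $h(X)$ abbreviate $c(g(X))$ and $h(g(X))$ for measurable $c:\Delta^{k-1}\to[k]$, $h:\Delta^{k-1}\to[0,1]$; $g$ is measurable. The Bregman divergence of $\varphi$ is $d_\varphi(a,b)=\varphi(a)-\varphi(b)-\varphi'(b)(a-b)$. The (Nadaraya–Watson) kernel regression estimator with bandwidth $\sigma$ from the first $n$ samples is $$\hat m_\sigma(t)=\frac{\sum_{i=1}^n K_\sigma(t-h(x_i))\,\mathbf{1}_{y_i=c(x_i)}}{\sum_{i=1}^n K_\sigma(t-h(x_i))},\qquad K_\sigma(u)=\tfrac1\sigma K(u/\sigma).$$ The density of $h(X)$ is with respect to Lebesgue measure, and ''bounded away from zero'' and continuity of the conditional expectation (some version of it) are meant on the support of the law of $h(X)$, a compact subset of $[0,1]$. *)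

(* Defs.v *)
From HB Require Import structures.
From mathcomp Require Import all_boot all_order all_algebra.
From mathcomp Require Import all_classical all_reals all_analysis.

Set Implicit Arguments.
Unset Strict Implicit.
Unset Printing Implicit Defensive.

Import Order.TTheory GRing.Theory Num.Theory.
Import numFieldNormedType.Exports.

Local Open Scope classical_set_scope.
Local Open Scope ring_scope.

(* A measurableType is pointed, so the label set [k] is written 'I_k.+1 (that
   is, with k.+1 classes); it carries the discrete sigma-algebra. *)
HB.instance Definition _ (k : nat) := isPointed.Build 'I_k.+1 ord0.
HB.instance Definition _ (k : nat) :=
  @isMeasurable.Build default_measure_display 'I_k.+1
    discrete_measurable discrete_measurable0
    discrete_measurableC discrete_measurableU.

Section Probability.
Context {R : realType}.

Definition simplex (k : nat) : set (k.-tuple R) :=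
  [set p | (forall i, 0 <= tnth p i) /\ \sum_i tnth p i = 1].

Definition mutually_independent {dO dT : measure_display}
    {Omega : measurableType dO} {T : measurableType dT}
    (P : probability Omega R) (Z : nat -> Omega -> T) : Prop :=
  forall (J : seq nat) (A : nat -> set T), uniq J ->
    (forall i, measurable (A i)) ->
    P (\big[setI/setT]_(i <- J) (Z i @^-1` A i)) =
    (\prod_(i <- J) P (Z i @^-1` A i))%E.

Definition iid {dO dT : measure_display}
    {Omega : measurableType dO} {T : measurableType dT}
    (P : probability Omega R) (law : probability T R)
    (Z : nat -> {RV P >-> T}) : Prop :=
  (forall i A, measurable A -> distribution P (Z i) A = law A) /\
  mutually_independent P (fun i w => Z i w).

Definition cvg_in_probability {dO : measure_display}
    {Omega : measurableType dO} (P : probability Omega R)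
    (D : nat -> Omega -> \bar R) (l : \bar R) : Prop :=
  forall eps : R, 0 < eps ->
    (fun n => P [set w | (eps%:E < `|D n w - l|)%E]) @ \oo --> 0%E.

(* [m] is a version of t |-> E[Z | S = t]. *)
Definition is_regression {dT : measure_display} {T : measurableType dT}
    (P : probability T R) (Z S : T -> R) (m : R -> R) : Prop :=
  [/\ measurable_fun setT m,
      P.-integrable setT (fun x => (m (S x))%:E) &
      forall B : set R, measurable B ->
        (\int[P]_(x in S @^-1` B) (m (S x))%:E =
         \int[P]_(x in S @^-1` B) (Z x)%:E)%E].

Definition law_support (law : set R -> \bar R) : set R :=
  [set t | forall U : set R, open U -> U t -> (0 < law U)%E].

Definition has_density (law : set R -> \bar R) (f : R -> R) : Prop :=
  [/\ measurable_fun setT f, forall t, 0 <= f t &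
      forall B : set R, measurable B ->
        law B = (\int[lebesgue_measure]_(t in B) (f t)%:E)%E].

Definition has_density_bounded_away_from_zero (law : set R -> \bar R) : Prop :=
  exists2 f, has_density law f &
    exists2 b : R, 0 < b & forall t, law_support law t -> b <= f t.

End Probability.

Section Bregman.
Context {R : realType}.
Implicit Type phi : R -> \bar R.

(* Only the values of [phi] on [0, 1] matter. The derivative is taken along
   [0, 1], hence it is one-sided at 0 and at 1. *)
Definition diff_quotient phi (t s : R) : R :=
  (fine (phi s) - fine (phi t)) / (s - t).

Definition deriv01 phi (t : R) : R :=
  lim (diff_quotient phi t s @[s --> within `[0, 1] t^']).

(* [fine] sends infinite values to 0, so finiteness, which is part of real
   differentiability, has to be stated separately. *)
Definition C1_on01 phi : Prop :=
  [/\ forall t, t \in `[0, 1] -> phi t \is a fin_num,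
      forall t, t \in `[0, 1] ->
        cvg (diff_quotient phi t s @[s --> within `[0, 1] t^']) &
      {within `[0, 1], continuous (deriv01 phi)}].

Definition strictly_convex_on01 phi : Prop :=
  forall a b t : R, a \in `[0, 1] -> b \in `[0, 1] -> a != b ->
    0 < t < 1 ->
    (phi (t * a + (1 - t) * b)%R < t%:E * phi a + (1 - t)%:E * phi b)%E.

Definition bregman phi (a b : R) : \bar R :=
  (phi a - phi b - (deriv01 phi b * (a - b))%:E)%E.

End Bregman.

Section KernelRegression.
Context {R : realType}.

Definition admissible_kernel (K : R -> R) : Prop :=
  (exists Kmax : R, forall x, 0 <= K x <= Kmax) /\
  exists L : R -> R,
    [/\ forall x, K x = L `|x|,
        forall u v, 0 <= u -> u <= v -> L v <= L u,
        u * L u @[u --> +oo] --> (0 : R) &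
        exists2 u, 0 < u & 0 < L u].

Definition scaled_kernel (K : R -> R) (sigma u : R) : R :=
  sigma^-1 * K (u / sigma).

(* In the next two definitions, s i = h(x_i) and r i = 1_{y_i = c(x_i)}; the
   samples are indexed from 0. *)
Definition nadaraya_watson (K : R -> R) (sigma : R) (n : nat)
    (s r : nat -> R) (t : R) : R :=
  (\sum_(i < n) scaled_kernel K sigma (t - s i) * r i) /
  (\sum_(i < n) scaled_kernel K sigma (t - s i)).

Definition plugin (phi : R -> \bar R) (K : R -> R) (sigma : R) (n : nat)
    (s r : nat -> R) : \bar R :=
  ((n%:R^-1)%:E *
   \sum_(i < n) (phi (nadaraya_watson K sigma n s r (s i)) - phi (s i)
                 - (deriv01 phi (s i) * (r i - s i))%:E))%E.

End KernelRegression.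

(* Main.v *)
Require Import Defs.
From HB Require Import structures.
From mathcomp Require Import all_boot all_order all_algebra.
From mathcomp Require Import all_classical all_reals all_analysis.
From mathcomp Require Import measurable_realfun.
From mathcomp Require Import ring lra.

Set Implicit Arguments.
Unset Strict Implicit.
Unset Printing Implicit Defensive.

Import Order.TTheory GRing.Theory Num.Theory.
Import numFieldNormedType.Exports.

Local Open Scope classical_set_scope.
Local Open Scope ring_scope.

(** Write [s_i] and [r_i] for confidence and correctness of the samples, [M] for
    the regression function, [xi_i = r_i - M (s_i)], and [D_i] for the kernel
    mass [sum_j K ((s_i - s_j) / sigma)] at a sample point.

    Everything rests on a deterministic bound: as [K >= L u > 0] on [[-u, u]], [D_i] is at least [L u] times the number of
    samples in the cell of width [u * sigma] containing [s_i], so that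
    [sum_i 1 / D_i <= (1 / (u * sigma) + 1) / L u], the number of cells over
    [L u]. The estimation error at [s_i] splits as [T_i / D_i + B_i / D_i], with
    [T_i = sum_j K ((s_i - s_j) / sigma) * xi_j] and a bias [B_i]. By uniform
    continuity of [M] and monotonicity of [L],
    [|B_i| <= e * D_i + n * L (delta / sigma)], whose average after division by
    [D_i] is small since [x * L x] tends to 0. For every [theta > 0],
    [(T_i / D_i)^2 <= T_i^2 / theta^2 + theta / D_i]; the cross terms of
    [E (T_i^2)] vanish by independence, whence [E (T_i^2) <= n * B^2], and
    [theta = eta * n * sigma] gives an error [O (1 / (n * sigma^2)) + O (eta)].
    With the second moment of an i.i.d. sum and Markov's inequality this yields
    convergence in probability.

    [m] is continuous only on the support of the law of [h(X)]; it is replaced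
    by a Tietze extension, which changes it on a null set only. *)

(** * Bounded measurable functions *)

Section bounded_measurable.
Context {R : realType} {dT : measure_display} {T : measurableType dT}.
Implicit Types f g : T -> R.

Definition bounded_measurable f :=
  measurable_fun setT f /\ exists C, forall x, `|f x| <= C.

Lemma bounded_measurable_cst (a : R) : bounded_measurable (fun=> a).
Proof. by split; [exact: measurable_cst|exists `|a|]. Qed.

Lemma bounded_measurableD f g : bounded_measurable f -> bounded_measurable g ->
  bounded_measurable (fun x => f x + g x).
Proof.
move=> [mf [C fC]] [mg [C' gC]]; split; first exact: measurable_funD.
by exists (C + C') => x; rewrite (le_trans (ler_normD _ _))// lerD.
Qed.

Lemma bounded_measurableM f g : bounded_measurable f -> bounded_measurable g ->
  bounded_measurable (fun x => f x * g x).
Proof.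
move=> [mf [C fC]] [mg [C' gC]]; split; first exact: measurable_funM.
by exists (C * C') => x; rewrite normrM ler_pM.
Qed.

Lemma bounded_measurableB f g : bounded_measurable f -> bounded_measurable g ->
  bounded_measurable (fun x => f x - g x).
Proof.
move=> [mf [C fC]] [mg [C' gC]]; split; first exact: measurable_funB.
by exists (C + C') => x; rewrite (le_trans (ler_normB _ _))// lerD.
Qed.

Lemma bounded_measurable_norm f : bounded_measurable f ->
  bounded_measurable (fun x => `|f x|).
Proof.
move=> [mf [C fC]]; split; first exact: measurableT_comp.
by exists C => x; rewrite normr_id.
Qed.

Lemma bounded_measurable_sum n (F : nat -> T -> R) :
  (forall i, bounded_measurable (F i)) ->
  bounded_measurable (fun x => \sum_(i < n) F i x).
Proof.
move=> bF; elim: n => [|n ih].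
  by under eq_fun do rewrite big_ord0; exact: bounded_measurable_cst.
by under eq_fun do rewrite big_ord_recr; exact: bounded_measurableD.
Qed.

Variable P : probability T R.

Lemma bounded_measurable_integrable f :
  bounded_measurable f -> P.-integrable setT (EFin \o f).
Proof.
move=> [mf [C fC]]; apply: measurable_bounded_integrable => //.
  by rewrite -ge0_fin_numE// fin_num_measure.
exists C; split; first exact: num_real.
by move=> x Cx y _ /=; exact: le_trans (fC y) (ltW Cx).
Qed.

Lemma bounded_measurable_EFin f : bounded_measurable f ->
  (\int[P]_x (f x)%:E)%E = (\int[P]_x f x)%:E.
Proof.
move=> /bounded_measurable_integrable bf; rewrite fineK//.
by apply: integrable_fin_num.
Qed.

Lemma Rintegral_sum n (F : nat -> T -> R) :
  (forall i, bounded_measurable (F i)) ->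
  \int[P]_x (\sum_(i < n) F i x) = \sum_(i < n) \int[P]_x F i x.
Proof.
move=> bF; elim: n => [|n ih].
  rewrite big_ord0; under eq_Rintegral do rewrite big_ord0.
  by rewrite Rintegral_cst// mul0r.
rewrite big_ord_recr /= -ih -RintegralD//.
- by apply: eq_Rintegral => x _; rewrite big_ord_recr.
- by apply: bounded_measurable_integrable; exact: bounded_measurable_sum.
- exact: bounded_measurable_integrable.
Qed.

Lemma Rintegral_le_cst f (C : R) : bounded_measurable f ->
  (forall x, f x <= C) -> \int[P]_x f x <= C.
Proof.
move=> bf fC; suff <- : \int[P]_x C = C.
  apply: le_Rintegral => //; first exact: bounded_measurable_integrable.
  exact/bounded_measurable_integrable/bounded_measurable_cst.
by rewrite Rintegral_cst// [fine _](congr1 fine (probability_setT P)) mulr1.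
Qed.

(** Expanding the square leaves only the diagonal, whose [n] terms are at most [B ^+ 2]. *)
Lemma Rintegral_sqr_sum_orthogonal n (F : nat -> T -> R) (B : R) :
  (forall i, bounded_measurable (F i)) ->
  (forall i x, `|F i x| <= B) ->
  (forall i j, i != j -> \int[P]_x (F i x * F j x) = 0) ->
  \int[P]_x ((\sum_(i < n) F i x) ^+ 2) <= n%:R * B ^+ 2.
Proof.
move=> bF FB F0.
have -> : \int[P]_x ((\sum_(i < n) F i x) ^+ 2) =
    \sum_(i < n) \sum_(j < n) \int[P]_x (F i x * F j x).
  transitivity (\sum_(i < n) \int[P]_x (\sum_(j < n) F i x * F j x)).
    rewrite -(@Rintegral_sum n (fun i x => \sum_(j < n) F i x * F j x)).
      apply: eq_Rintegral => x _; rewrite expr2 mulr_suml.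
      by apply: eq_bigr => i _; rewrite mulr_sumr.
    move=> i; apply: (@bounded_measurable_sum n (fun j x => F i x * F j x)) => j.
    exact: bounded_measurableM.
  apply: eq_bigr => i _; apply: (@Rintegral_sum n (fun j x => F i x * F j x)) => j.
  exact: bounded_measurableM.
apply: (@le_trans _ _ (\sum_(i < n) B ^+ 2)); last first.
  by rewrite sumr_const card_ord mulr_natl.
apply: ler_sum => i _.
rewrite (bigD1 i)//= big1 ?addr0; last by move=> j ji; rewrite F0// eq_sym.
apply: Rintegral_le_cst; first exact: bounded_measurableM.
by move=> x; rewrite (le_trans (ler_norm _))// normrM expr2 ler_pM.
Qed.

(** Markov's inequality for any event inside the superlevel set: the event may concern the estimator
    while [f] is a majorant with small mean. *)
Lemma le_measure_markov f (A : set T) (e : R) : bounded_measurable f ->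
  (forall x, 0 <= f x) -> 0 < e -> measurable A -> (forall x, A x -> e <= f x) ->
  (P A <= (e^-1 * \int[P]_x f x)%:E)%E.
Proof.
move=> bf f0 e0 mA Af.
have -> : P A = (\int[P]_x (\1_A x)%:E)%E.
  by rewrite integral_indic// setIT.
have bA : bounded_measurable (\1_A : T -> R).
  split; first exact: measurable_indic.
  by exists 1 => x; rewrite indicE; case: (x \in A); rewrite /= ?normr1 ?normr0.
have bef : bounded_measurable (fun x => e^-1 * f x).
  by apply: bounded_measurableM => //; exact: bounded_measurable_cst.
rewrite -RintegralZl//; last exact: bounded_measurable_integrable.
rewrite (bounded_measurable_EFin bA) lee_fin.
apply: le_Rintegral => //; [exact: bounded_measurable_integrable|
  exact: bounded_measurable_integrable|move=> x _].
rewrite indicE; case: (boolP (x \in A)) => [|_ /=].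
  by rewrite inE => /Af efx; rewrite ler_pdivlMl// mulr1.
by rewrite mulr_ge0// invr_ge0 ltW.
Qed.

End bounded_measurable.

Lemma bounded_measurable_comp {R : realType} {d1 d2 : measure_display}
  {T1 : measurableType d1} {T2 : measurableType d2} (f : T2 -> R) (g : T1 -> T2) :
  bounded_measurable f -> measurable_fun setT g -> bounded_measurable (f \o g).
Proof.
move=> [mf [C fC]] mg; split; first exact: measurableT_comp.
by exists C => x; exact: fC.
Qed.

(** * Independence *)

Section independence.
Context {R : realType} {dO dT : measure_display} {Omega : measurableType dO}
  {T : measurableType dT} (P : probability Omega R).

(** Independence makes the joint law a product, and Fubini's theorem integrates over [X] first,
    where every section has mean zero. *)
Lemma Rintegral_independent_eq0 {d' : measure_display} {T' : measurableType d'}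
    (X : {mfun Omega >-> T}) (Y : {mfun Omega >-> T'}) (F : T * T' -> R) :
  (forall A B, measurable A -> measurable B ->
     P (X @^-1` A `&` Y @^-1` B) = (P (X @^-1` A) * P (Y @^-1` B))%E) ->
  bounded_measurable F ->
  (forall y, \int[distribution P X]_x F (x, y) = 0) ->
  \int[P]_w F (X w, Y w) = 0.
Proof.
move=> indep bF F0.
have mXY : measurable_fun setT (fun w => (X w, Y w)).
  by apply: measurable_fun_pair; exact: measurable_funPT.
pose XY : {mfun Omega >-> (T * T')%type} :=
  HB.pack (fun w => (X w, Y w)) (isMeasurableFun.Build _ _ _ _ _ mXY).
have mF : measurable_fun setT (EFin \o F) by apply/measurable_EFinP; case: bF.
pose PX : probability T R := distribution P X.
pose PY : probability T' R := distribution P Y.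
have bFXY : bounded_measurable (F \o XY) by exact: bounded_measurable_comp.
have iF := bounded_measurable_integrable P bFXY.
rewrite /Rintegral -(@integral_distribution _ _ _ _ _ P XY (EFin \o F) mF iF).
have iF2 : (PX \x PY)%E.-integrable setT (EFin \o F).
  exact: bounded_measurable_integrable.
suff -> : (\int[distribution P XY]_y (EFin \o F) y = 0)%E by [].
transitivity (\int[PX \x PY]_y (EFin \o F) y)%E.
  apply: eq_measure_integral => A mA _.
  exact/esym/product_measure_unique.
apply: etrans (esym (integral21_prod_meas1 iF2)) _.
rewrite integral0_eq// => y _; rewrite /fubini_G.
have bFy : bounded_measurable (fun x => F (x, y)).
  by apply: (@bounded_measurable_comp _ _ _ _ _ F (fun x => (x, y))).
have := bounded_measurable_EFin PX bFy; rewrite /= => ->.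
by rewrite F0.
Qed.

(** Independence on rectangles extends to the product sigma-algebra, since rectangles form a
    generating pi-system. The case [i = l] is allowed and serves for pairs with a repeated entry. *)
Lemma independent_pair (Z : nat -> {mfun Omega >-> T}) (i j l : nat) :
  mutually_independent P (fun i w => Z i w) -> j != i -> j != l ->
  forall (A : set T) (B : set (T * T)), measurable A -> measurable B ->
  P (Z j @^-1` A `&` (fun w => (Z i w, Z l w)) @^-1` B) =
  (P (Z j @^-1` A) * P ((fun w => (Z i w, Z l w)) @^-1` B))%E.
Proof.
move=> indep ji jl A B mA mB.
have indep2 (p q : nat) (C D : set T) : p != q -> measurable C -> measurable D ->
    P (Z p @^-1` C `&` Z q @^-1` D) = (P (Z p @^-1` C) * P (Z q @^-1` D))%E.
  move=> pq mC mD.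
  have := indep [:: p; q] (fun k => if k == p then C else D).
  rewrite /= inE pq => /(_ isT) H.
  have {}H := H (fun k => ltac:(by case: ifP)).
  by move: H; rewrite !big_cons !big_nil setIT mule1 eqxx eq_sym (negbTE pq).
have indep3 (C D : set T) : measurable C -> measurable D ->
    P (Z j @^-1` A `&` (Z i @^-1` C `&` Z l @^-1` D)) =
    (P (Z j @^-1` A) * P (Z i @^-1` C `&` Z l @^-1` D))%E.
  move=> mC mD; have [<-|il] := eqVneq i l.
    rewrite -preimage_setI; apply: indep2 => //; exact: measurableI.
  have := indep [:: j; i; l] (fun k => if k == j then A else if k == i then C else D).
  rewrite /= !inE negb_or ji jl il => /(_ isT) H.
  have {}H := H (fun k => ltac:(by case: ifP => // _; case: ifP)).
  move: H; rewrite !big_cons !big_nil setIT mule1 eqxx.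
  by rewrite (eq_sym i j) (eq_sym l j) (negbTE ji) (negbTE jl) eqxx
    (eq_sym l i) (negbTE il) indep2.
have mil : measurable_fun setT (fun w => (Z i w, Z l w)).
  by apply: measurable_fun_pair; exact: measurable_funPT.
have mjA : measurable (Z j @^-1` A).
  by rewrite -[X in measurable X]setTI; exact: (measurable_funPT (Z j)).
have PjA : P (Z j @^-1` A) \is a fin_num by rewrite fin_num_measure.
pose W : {mfun Omega >-> (T * T)%type} :=
  HB.pack (fun w => (Z i w, Z l w)) (isMeasurableFun.Build _ _ _ _ _ mil).
(* As functions of [B], both sides are finite measures: the push-forward by [W] of [P] restricted to
   the event on [Z j], and the law of [W] scaled by the probability of that event. *)
pose c : {nonneg R} := NngNum (fine_ge0 (measure_ge0 P (Z j @^-1` A))).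
pose m1_ : {measure set (T * T) -> \bar R} := pushforward (mrestr P mjA) W.
pose m1 := m1_ mil.
pose m2 : {measure set (T * T) -> \bar R} := mscale c (distribution P W).
have m12 : m1 B = m2 B.
  pose G : set (set (T * T)) :=
    [set X | exists A, measurable A /\ exists B, measurable B /\ X = A `*` B].
  apply: (measure_unique G (fun=> setT)) => //.
  - rewrite measurable_prod_measurableType //; congr (<<s _ >>).
    rewrite predeqE => X; split => [[C mC [D mD <-]]|[C [mC [D [mD ->]]]]].
      by exists C; split => //; exists D.
    by exists C => //; exists D.
  - move=> /= _ _ [X1 [mX1 [X2 [mX2 ->]]]] [Y1 [mY1 [Y2 [mY2 ->]]]].
    rewrite -setXI; exists (X1 `&` Y1); split; first exact: measurableI.
    by exists (X2 `&` Y2); split => //; exact: measurableI.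
  - move=> _; exists setT; split => //; exists setT; split => //.
    by rewrite setXTT.
  - by rewrite bigcup_const.
  - move=> _ [C [mC [D [mD ->]]]].
    have := indep3 C D mC mD.
    rewrite /m1 /m1_ /m2 /= /pushforward /mrestr /mscale /= fineK// => <-.
    by rewrite setIC.
  - move=> k; rewrite -ge0_fin_numE//.
    have mI : measurable (W @^-1` setT `&` Z j @^-1` A).
      by rewrite preimage_setT setTI.
    exact: (fin_num_measure P _ mI).
by move: m12; rewrite /m1 /m1_ /m2 /= /pushforward /mrestr /mscale /= fineK// setIC.
Qed.

End independence.

(** * Deterministic bounds for kernel regression *)

(* Grouping the points into cells of width [w], the sum over each nonempty cell
   is at most [a^-1], and there are at most [w^-1 + 1] cells. *)
Lemma sum_inv_neighbour_count {R : realType} (n : nat) (s D : nat -> R) (w a : R) :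
  0 < w -> 0 < a -> (forall i, 0 <= s i <= 1) ->
  (forall i, (i < n)%N -> a * \sum_(j < n) (`|s i - s j| <= w)%R%:R <= D i) ->
  \sum_(i < n) (D i)^-1 <= (w^-1 + 1) / a.
Proof.
move=> w0 a0 s01 aD.
pose q i := Num.truncn (s i / w).
pose M := Num.truncn w^-1.
have sw0 i : 0 <= s i / w by rewrite divr_ge0 ?(ltW w0)//; case/andP: (s01 i).
have qM i : (q i < M.+1)%N.
  rewrite ltnS; apply: le_truncn; rewrite ler_pdivrMr// mulVf ?gt_eqF//.
  by case/andP: (s01 i).
(* Indices with the same [q] have their points in one half-open interval of length [w]. *)
have qw i j : q i = q j -> `|s i - s j| <= w.
  move=> qij.
  have /andP[i1 i2] := truncn_itv (sw0 i); have /andP[j1 j2] := truncn_itv (sw0 j).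
  rewrite -!/(q _) qij in i1 i2 j1 j2.
  move: i1 i2 j1 j2; rewrite ler_pdivlMr// ltr_pdivrMr// ler_pdivlMr// ltr_pdivrMr//.
  by rewrite -natr1 => *; rewrite ler_norml; apply/andP; split; lra.
pose N c : R := \sum_(j < n) (q j == c)%:R.
have N0 c : 0 <= N c by apply: sumr_ge0.
have N1 (i : 'I_n) : 1 <= N (q i).
  by rewrite /N (bigD1 i)//= eqxx lerDl sumr_ge0.
have aN (i : 'I_n) : a * N (q i) <= D i.
  apply: le_trans (aD i (ltn_ord i)); rewrite ler_wpM2l ?(ltW a0)//.
  apply: ler_sum => j _; case: eqP => [/esym/qw ->//|_].
  by rewrite ler_nat.
apply: (@le_trans _ _ (\sum_(i < n) (a * N (q i))^-1)).
  apply: ler_sum => i _; rewrite lef_pV2// posrE.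
    by apply: lt_le_trans (aN i); rewrite mulr_gt0// (lt_le_trans ltr01).
  by rewrite mulr_gt0// (lt_le_trans ltr01).
rewrite (partition_big (fun i : 'I_n => Ordinal (qM i)) xpredT)//=.
apply: (@le_trans _ _ (\sum_(c < M.+1) a^-1)).
  apply: ler_sum => c _.
  have -> : \sum_(i < n | Ordinal (qM i) == c) (a * N (q i))^-1 =
      N c * (a * N c)^-1.
    rewrite /N big_distrl /= big_mkcond /=; apply: eq_bigr => i _.
    rewrite -val_eqE /=; case: eqP => [->|_]; last by rewrite mul0r.
    by rewrite mul1r.
  (* An empty cell contributes 0, any other exactly [a^-1]. *)
  have [->|Nc] := eqVneq (N c) 0; first by rewrite mul0r invr_ge0 ltW.
  by rewrite invfM mulrCA mulfV// mulr1.
rewrite sumr_const card_ord -mulr_natl ler_wpM2r ?invr_ge0 ?(ltW a0)//.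
by rewrite -natr1 lerD2r truncn_le// invr_ge0 ltW.
Qed.

Section nadaraya_watson_error.
Context {R : realType}.
Variables (K L : R -> R) (B u sigma : R).
Hypothesis K_bound : forall x, 0 <= K x <= B.
Hypothesis K_radial : forall x, K x = L `|x|.
Hypothesis L_noninc : forall x y, 0 <= x -> x <= y -> L y <= L x.
Hypothesis u_gt0 : 0 < u.
Hypothesis Lu_gt0 : 0 < L u.
Hypothesis sigma_gt0 : 0 < sigma.
Variables (n : nat) (s r : nat -> R) (M : R -> R).
Hypothesis s01 : forall i, 0 <= s i <= 1.
Hypothesis r01 : forall i, 0 <= r i <= 1.
Hypothesis M01 : forall t, 0 <= M t <= 1.

Definition kweight i j := K ((s i - s j) / sigma).
Definition kmass i := \sum_(j < n) kweight i j.
Definition kdeviation i := \sum_(j < n) kweight i j * (r j - M (s j)).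

Lemma kweight_ge0 i j : 0 <= kweight i j.
Proof. by case/andP: (K_bound ((s i - s j) / sigma)). Qed.

(** The sample itself contributes [K 0 = L 0 >= L u], so no quotient below has a zero
    denominator. *)
Lemma kmass_gt0 i : (i < n)%N -> 0 < kmass i.
Proof.
move=> ni; rewrite /kmass (bigD1 (Ordinal ni))//= ltr_pwDl//.
  rewrite /kweight subrr mul0r K_radial normr0.
  by apply: lt_le_trans Lu_gt0 _; exact/L_noninc/ltW.
by apply: sumr_ge0 => j _; exact: kweight_ge0.
Qed.

Lemma nadaraya_watsonE i : nadaraya_watson K sigma n s r (s i) =
  (\sum_(j < n) kweight i j * r j) / kmass i.
Proof.
rewrite /nadaraya_watson /scaled_kernel -mulr_sumr.
have -> : \sum_(j < n) sigma^-1 * K ((s i - s j) / sigma) * r j =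
    sigma^-1 * \sum_(j < n) kweight i j * r j.
  by rewrite mulr_sumr; apply: eq_bigr => j _; rewrite mulrA.
by rewrite invfM mulrACA mulfV ?mul1r// invr_eq0 gt_eqF.
Qed.

(** A weighted average with nonnegative weights stays in [0, 1], where [phi] is under control. *)
Lemma nadaraya_watson01 i : (i < n)%N ->
  0 <= nadaraya_watson K sigma n s r (s i) <= 1.
Proof.
move=> ni; rewrite nadaraya_watsonE; have D0 := kmass_gt0 ni.
rewrite divr_ge0 ?(ltW D0)//=; last first.
  by apply: sumr_ge0 => j _; rewrite mulr_ge0 ?kweight_ge0//; case/andP: (r01 j).
rewrite ler_pdivrMr// mul1r; apply: ler_sum => j _.
by rewrite ler_piMr ?kweight_ge0//; case/andP: (r01 j).
Qed.

(** Every sample within [u * sigma] of [s i] has weight at least [L u], as the cell count with width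
    [u * sigma] requires. *)
Lemma sum_inv_kmass :
  \sum_(i < n) (kmass i)^-1 <= ((u * sigma)^-1 + 1) / L u.
Proof.
apply: (@sum_inv_neighbour_count _ _ s) => //; first exact: mulr_gt0.
move=> i _; rewrite /kmass mulr_sumr; apply: ler_sum => j _.
case: (boolP (`|s i - s j| <= u * sigma)) => [h|_]; last by rewrite mulr0 kweight_ge0.
rewrite mulr1 /kweight K_radial; apply: L_noninc => //.
by rewrite normrM [`|sigma^-1|]gtr0_norm ?invr_gt0// ler_pdivrMr.
Qed.

(* A deviation quotient [T / D] is at most 1, so where [D < theta] it is
   dominated by [theta / D]. *)
Lemma nadaraya_watson_sqr_error i (theta delta e : R) :
  (i < n)%N -> 0 < theta -> 0 < delta ->
  (forall x y, 0 <= x <= 1 -> 0 <= y <= 1 -> `|x - y| < delta ->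
     `|M x - M y| <= e) ->
  (nadaraya_watson K sigma n s r (s i) - M (s i)) ^+ 2 <=
  2 * (theta ^- 2 * kdeviation i ^+ 2) + 2 * e
    + 2 * ((theta + n%:R * L (delta / sigma)) * (kmass i)^-1).
Proof.
move=> ni th0 de0 Mcont; have D0 := kmass_gt0 ni.
have L0 x : 0 <= x -> 0 <= L x.
  by move=> x0; rewrite -[x]ger0_norm// -K_radial; case/andP: (K_bound x).
(* The bias: [kdeviation] takes the residuals [r j - M (s j)], and [b] keeps the variation of [M]
   around [s i]. *)
pose b := \sum_(j < n) kweight i j * (M (s j) - M (s i)).
have -> : nadaraya_watson K sigma n s r (s i) - M (s i) =
    kdeviation i / kmass i + b / kmass i.
  rewrite nadaraya_watsonE -mulrDl.
  have -> : kdeviation i + b = \sum_(j < n) kweight i j * r j - kmass i * M (s i).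
    rewrite /kdeviation /b /kmass -big_split mulr_suml -sumrB.
    by apply: eq_bigr => j _ /=; ring.
  by rewrite mulrBl [X in _ = _ - X]mulrAC mulfV ?mul1r// gt_eqF.
have absM x y : `|M x - M y| <= 1.
  by have := M01 x; have := M01 y; rewrite ler_norml; lra.
have absr j : `|r j - M (s j)| <= 1.
  by have := M01 (s j); have := r01 j; rewrite ler_norml; lra.
have devD : `|kdeviation i| <= kmass i.
  apply: le_trans (ler_norm_sum _ _ _) _; apply: ler_sum => j _.
  by rewrite normrM ger0_norm ?kweight_ge0// ler_piMr ?kweight_ge0.
have bD : `|b| <= kmass i.
  apply: le_trans (ler_norm_sum _ _ _) _; apply: ler_sum => j _.
  by rewrite normrM ger0_norm ?kweight_ge0// ler_piMr ?kweight_ge0.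
have be : `|b| <= e * kmass i + n%:R * L (delta / sigma).
  apply: le_trans (ler_norm_sum _ _ _) _.
  rewrite /kmass mulr_sumr mulr_natl -[X in _ *+ X]card_ord -sumr_const.
  rewrite -big_split /=; apply: ler_sum => j _.
  rewrite normrM ger0_norm ?kweight_ge0//.
  (* The modulus applied to the pair 0, 0 shows that [e] is nonnegative. *)
  have e0 : 0 <= e.
    apply: le_trans (normr_ge0 _) (Mcont 0 0 _ _ _); rewrite ?lexx ?ler01//.
    by rewrite subrr normr0.
  (* Near samples are controlled by the modulus of [M]. For far ones [M] varies by at most 1 and the
     weight is at most [L (delta / sigma)]. *)
  have [near|far] := ltP `|s j - s i| delta.
    apply: (@le_trans _ _ (e * kweight i j)).
      by rewrite mulrC ler_wpM2r ?kweight_ge0// Mcont.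
    by rewrite lerDl L0// divr_ge0// ltW.
  apply: (@le_trans _ _ (L (delta / sigma))); last first.
    by rewrite lerDr mulr_ge0 ?kweight_ge0.
  apply: (@le_trans _ _ (kweight i j)).
    by rewrite ler_piMr ?kweight_ge0.
  rewrite /kweight K_radial; apply: L_noninc; first by rewrite divr_ge0 ?ltW.
  rewrite normrM [`|sigma^-1|]gtr0_norm ?invr_gt0// ler_pM2r ?invr_gt0//.
  by rewrite distrC.
set D := kmass i in D0 devD bD be *; set T := kdeviation i in devD *.
have TD : (T / D) ^+ 2 <= theta ^- 2 * T ^+ 2 + theta * D^-1.
  have [thD|Dth] := leP theta D.
    apply: (@le_trans _ _ (theta ^- 2 * T ^+ 2)).
      rewrite exprMn mulrC ler_wpM2r ?sqr_ge0 ?exprVn//.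
      by rewrite lef_pV2 ?posrE ?exprn_gt0// lerXn2r// nnegrE ltW.
    by rewrite lerDl divr_ge0// ltW.
  apply: (@le_trans _ _ (theta * D^-1)); last first.
    by rewrite lerDr mulr_ge0 ?sqr_ge0// invr_ge0 sqr_ge0.
  apply: (@le_trans _ _ 1); last by rewrite ler_pdivlMr// mul1r ltW.
  rewrite -real_normK ?num_real// expr_le1// normrM.
  by rewrite [`|D^-1|]gtr0_norm ?invr_gt0// ler_pdivrMr// mul1r.
(* As [|b / D| <= 1], its square is at most its absolute value; the bound stays linear in [D^-1], so
   [sum_inv_kmass] can sum it. *)
have BD : (b / D) ^+ 2 <= e + n%:R * L (delta / sigma) * D^-1.
  apply: (@le_trans _ _ `|b / D|).
    rewrite -real_normK ?num_real// expr2 ler_piMr// normrM.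
    by rewrite [`|D^-1|]gtr0_norm ?invr_gt0// ler_pdivrMr// mul1r.
  rewrite normrM [`|D^-1|]gtr0_norm ?invr_gt0// ler_pdivrMr//.
  by rewrite mulrDl divfK ?gt_eqF.
have : (T / D + b / D) ^+ 2 <= 2 * (T / D) ^+ 2 + 2 * (b / D) ^+ 2.
  by have := sqr_ge0 (T / D - b / D); lra.
move/le_trans; apply; rewrite [in leRHS]mulrDl.
by move: TD BD; lra.
Qed.

(** The term in [dphi] does not involve the estimate and cancels when the estimate is replaced by
    [M (s i)]. The change in [phi] is bounded through squares, so only the mean squared error
    matters; what remains is the empirical mean computed with [M] itself, minus [v]. *)
Lemma plugin_deviation (phi dphi : R -> R) (e C theta delta e' v : R) :
  (0 < n)%N -> 0 < theta -> 0 < delta -> 0 <= C ->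
  (forall x y, 0 <= x <= 1 -> 0 <= y <= 1 -> `|x - y| < delta ->
     `|M x - M y| <= e') ->
  (forall x y, 0 <= x <= 1 -> 0 <= y <= 1 ->
     `|phi x - phi y| <= e + C * (x - y) ^+ 2) ->
  `|n%:R^-1 * \sum_(i < n) (phi (nadaraya_watson K sigma n s r (s i)) - phi (s i)
      - dphi (s i) * (r i - s i)) - v| <=
  e + C * (n%:R^-1 * (2 * theta ^- 2 * \sum_(i < n) kdeviation i ^+ 2) + 2 * e'
           + 2 * (n%:R^-1 * (theta + n%:R * L (delta / sigma))
                  * (((u * sigma)^-1 + 1) / L u)))
    + `|n%:R^-1 * \sum_(i < n) (phi (M (s i)) - phi (s i)
          - dphi (s i) * (r i - s i) - v)|.
Proof.
move=> n0 th0 de0 C0 Mcont phimod.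
have nR0 : 0 < n%:R :> R by rewrite ltr0n.
have nV0 : 0 <= n%:R^-1 :> R by rewrite invr_ge0 ltW.
pose m i := nadaraya_watson K sigma n s r (s i).
set W := n%:R^-1 * \sum_(i < n) (phi (M (s i)) - _ - _ - v).
have -> : n%:R^-1 * \sum_(i < n) (phi (m i) - phi (s i) - dphi (s i) * (r i - s i)) - v =
    n%:R^-1 * (\sum_(i < n) (phi (m i) - phi (M (s i)))) + W.
  have {1}-> : v = n%:R^-1 * \sum_(i < n) v.
    by rewrite sumr_const card_ord -[v *+ n]mulr_natl mulKf// gt_eqF.
  rewrite /W -mulrBr -mulrDr -sumrB -big_split /=; congr (_ * _).
  by apply: eq_bigr => i _; ring.
apply: le_trans (ler_normD _ _) _; rewrite lerD2r.
rewrite normrM (ger0_norm nV0).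
pose S := \sum_(i < n) kdeviation i ^+ 2.
pose c := theta + n%:R * L (delta / sigma).
have c0 : 0 <= c.
  have ds0 : 0 <= delta / sigma by rewrite divr_ge0 ?ltW.
  apply: addr_ge0; first exact: ltW.
  apply: mulr_ge0; first exact: ltW.
  by rewrite -(ger0_norm ds0) -K_radial; case/andP: (K_bound (delta / sigma)).
have sum_sq : \sum_(i < n) (m i - M (s i)) ^+ 2 <=
    2 * theta ^- 2 * S + n%:R * (2 * e') + 2 * (c * (((u * sigma)^-1 + 1) / L u)).
  apply: (@le_trans _ _ (\sum_(i < n) (2 * theta ^- 2 * kdeviation i ^+ 2 + 2 * e'
      + 2 * c * (kmass i)^-1))).
    apply: ler_sum => i _; rewrite -!mulrA.
    exact: nadaraya_watson_sqr_error.
  rewrite !big_split /= -!mulr_sumr sumr_const card_ord -[e' *+ n]mulr_natl.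
  rewrite [2 * (n%:R * e')]mulrCA.
  by rewrite lerD2l -mulrA ler_wpM2l// ler_wpM2l// sum_inv_kmass.
apply: (@le_trans _ _ (n%:R^-1 * (n%:R * e + C * \sum_(i < n) (m i - M (s i)) ^+ 2))).
  rewrite ler_wpM2l//; apply: le_trans (ler_norm_sum _ _ _) _.
  rewrite mulr_sumr mulr_natl -[X in _ *+ X]card_ord -sumr_const -big_split /=.
  by apply: ler_sum => i _; rewrite phimod ?nadaraya_watson01.
rewrite mulrDr mulKf ?gt_eqF// lerD2l mulrCA ler_wpM2l//.
apply: le_trans (ler_wpM2l nV0 sum_sq) _.
rewrite !mulrDr [n%:R^-1 * (n%:R * _)]mulKf ?gt_eqF//.
rewrite lerD2l -mulrDr -/c le_eqVlt; apply/orP; left; apply/eqP; ring.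
Qed.

End nadaraya_watson_error.

(** * Uniform continuity, null sets and supports *)

Section continuity_on_unit_interval.
Context {R : realType}.
Implicit Types f : R -> R.

(** Heine's theorem by the near-covering form of compactness: around each [x] the property holds for
    all [x'] close to [x] and all small [d], hence for one [d] on the whole interval. *)
Lemma continuous_unif01 f (e : R) : continuous f -> 0 < e ->
  exists2 delta, 0 < delta & forall x y, 0 <= x <= 1 -> 0 <= y <= 1 ->
    `|x - y| < delta -> `|f x - f y| <= e.
Proof.
move=> cf e0.
have /compact_near_coveringP cpt := @segment_compact R 0 1.
have cover : \forall d \near (0 : R)^'+, `[0, 1]%classic `<=`
    [set x | forall y, `|x - y| < d -> `|f x - f y| <= e].
  apply: (cpt R (0^'+) (fun d x => forall y, `|x - y| < d -> `|f x - f y| <= e)).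
  move=> x _.
  have /cvgrPdist_lt/(_ (e / 2)) := cf x.
  rewrite divr_gt0// => /(_ isT)/nbhs_ballP[eta /= eta0 H].
  near=> x' d => /= y /= x'y.
  have xx' : `|x - x'| < eta / 2.
    near: x'; apply: nbhsx_ballx; exact: divr_gt0.
  have d2 : d < eta / 2.
    by near: d; apply: nbhs_right_lt; rewrite divr_gt0.
  have H1 : `|f x - f x'| < e / 2.
    by apply: H => /=; rewrite /ball /=; lra.
  have H2 : `|f x - f y| < e / 2.
    apply: H; rewrite /ball /=.
    have := ler_normD (x - x') (x' - y); rewrite addrA subrK; lra.
  have := ler_normD (f x' - f x) (f x - f y); rewrite addrA subrK.
  by move: H1; rewrite distrC; lra.
have : \forall d \near (0 : R)^'+, 0 < d /\ `[0, 1]%classic `<=`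
    [set x | forall y, `|x - y| < d -> `|f x - f y| <= e].
  by near=> d; split; [near: d; exact: nbhs_right_gt|near: d; exact: cover].
move=> /filter_ex[d [d0 H]]; exists d => // x y x01 _ xy.
by apply: H xy; rewrite /= in_itv.
Unshelve. all: end_near. Qed.

Lemma continuous_bounded01 f : continuous f ->
  exists2 C, 0 < C & forall x, 0 <= x <= 1 -> `|f x| <= C.
Proof.
move=> cf.
have cfw : {within `[(0 : R), 1], continuous f} by exact: continuous_subspaceT.
have [a _ fa] := EVT_max ler01 cfw; have [b _ fb] := EVT_min ler01 cfw.
exists (`|f a| + `|f b| + 1).
  by rewrite ltr_pwDr// addr_ge0.
move=> x x01; have x01' : x \in `[0, 1] by rewrite in_itv.
have := fa _ x01'; have := fb _ x01'; rewrite ler_norml.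
have := ler_norm (f a); have := ler_norm (- f b); rewrite normrN.
have := normr_ge0 (f a); have := normr_ge0 (f b).
by move=> *; apply/andP; split; lra.
Qed.

(** Points closer than [d] are handled by uniform continuity. For the others [(x - y) ^+ 2 / d ^+ 2]
    is at least 1, so a multiple of the square absorbs the crude bound [2 * B]. *)
Lemma continuous_sqr_modulus01 f (e : R) : continuous f -> 0 < e ->
  exists2 C, 0 < C & forall x y, 0 <= x <= 1 -> 0 <= y <= 1 ->
    `|f x - f y| <= e + C * (x - y) ^+ 2.
Proof.
move=> cf e0; have [d d0 H] := continuous_unif01 cf e0.
have [B B0 fB] := continuous_bounded01 cf.
exists (2 * B / d ^+ 2); first by rewrite divr_gt0 ?mulr_gt0 ?exprn_gt0.
move=> x y x01 y01; have [xyd|dxy] := ltP `|x - y| d.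
  rewrite -[leLHS]addr0 lerD ?H// mulr_ge0 ?sqr_ge0//.
  by rewrite divr_ge0 ?sqr_ge0 ?mulr_ge0 ?ltW.
rewrite -[leLHS]add0r lerD ?(ltW e0)//.
apply: (@le_trans _ _ (2 * B)).
  have := fB _ x01; have := fB _ y01; have := ler_normB (f x) (f y); lra.
rewrite mulrAC ler_pdivlMr ?exprn_gt0// ler_wpM2l ?mulr_ge0 ?(ltW B0)//.
rewrite -[(x - y) ^+ 2]real_normK ?num_real//.
by rewrite lerXn2r// nnegrE ltW.
Qed.

End continuity_on_unit_interval.

Section clamp.
Context {R : realType}.

Definition clamp01 (t : R) : R := Num.min 1 (Num.max 0 t).

Lemma clamp01_itv t : 0 <= clamp01 t <= 1.
Proof. by rewrite /clamp01 le_min ge_min le_max !lexx ler01. Qed.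

Lemma clamp01_id t : 0 <= t <= 1 -> clamp01 t = t.
Proof. by move=> /andP[t0 t1]; rewrite /clamp01 max_r// min_r. Qed.

Lemma continuous_clamp01 : continuous clamp01.
Proof.
move=> t; apply: (@continuous_min R R (cst 1) (cst 0 \max id)).
  exact: cst_continuous.
by apply: (@continuous_max R R (cst 0) id); [exact: cst_continuous|].
Qed.

(** Clamping extends a function on [0, 1] by its end values, which turns relative continuity into
    continuity on the line. *)
Lemma clamp01_continuous_within (f : R -> R) :
  {within `[0, 1], continuous f} -> continuous (f \o clamp01).
Proof.
move=> cf t.
have ct : `[(0 : R), 1]%classic (clamp01 t) by rewrite /= in_itv/= clamp01_itv.
move/subspace_continuousP : cf => /(_ _ ct) cft U /cft.
rewrite /= /within /= => /continuous_clamp01 near.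
rewrite !nbhs_filterE in near *.
apply: (@filterS _ (nbhs t) _ _ _ _ near) => x /=; apply.
by rewrite in_itv/= clamp01_itv.
Qed.

End clamp.

Section null_sets.
Local Open Scope ereal_scope.
Context {R : realType} {d : measure_display} {T : measurableType d}.
Variable mu : {measure set T -> \bar R}.
Import HBNNSimple.

(* The values of [phi] outside [0, 1] are arbitrary, so the Bregman integrand may
   fail to be measurable on a null set. An integral is a supremum of integrals of
   simple functions, each of which may be set to 0 on [N]. *)
Lemma ge0_integral_le_off_null (N : set T) (f g : T -> \bar R) :
  measurable N -> mu N = 0 -> (forall x, 0 <= f x) -> (forall x, 0 <= g x) ->
  (forall x, ~ N x -> f x = g x) -> \int[mu]_x f x <= \int[mu]_x g x.
Proof.
move=> mN N0 f0 g0 fg; rewrite !ge0_integralTE//.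
apply: ge_ereal_sup => _ [h /= hf <-].
pose h' := mul_nnsfun h (indic_nnsfun R (measurableC mN)).
have -> : sintegral mu h = sintegral mu h'.
  rewrite -!integralT_nnsfun; apply: ge0_ae_eq_integral => //.
  - exact/measurable_EFinP/measurable_funPT.
  - exact/measurable_EFinP/measurable_funPT.
  - by move=> x _; rewrite lee_fin; exact: fun_ge0.
  - by move=> x _; rewrite lee_fin; exact: fun_ge0.
  - exists N; split => // x /= /not_implyP[_] hx; apply: contrapT => Nx; apply: hx.
    by rewrite /h' /= /mindic indicE mem_set// mulr1.
apply: ereal_sup_ubound; exists h' => //= x.
rewrite /h' /= /mindic indicE; have [Nx|Nx] := pselect (N x).
  by rewrite memNset ?mulr0//= => /(_ Nx).
by rewrite mem_set//= mulr1 -fg.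
Qed.

Lemma eq_integral_off_null (N : set T) (f g : T -> \bar R) :
  measurable N -> mu N = 0 -> (forall x, ~ N x -> f x = g x) ->
  \int[mu]_x f x = \int[mu]_x g x.
Proof.
move=> mN N0 fg; rewrite integralE [RHS]integralE.
congr (_ - _); apply/eqP; rewrite eq_le; apply/andP; split;
  apply: (ge0_integral_le_off_null mN N0) => // x Nx;
  by rewrite ?funeposE ?funenegE fg.
Qed.

Lemma closed_law_support (law : set R -> \bar R) : closed (law_support law).
Proof.
rewrite -[law_support law]setCK; apply: open_closedC.
rewrite openE => t /= /existsNP[U /not_implyP[oU /not_implyP[Ut lawU]]].
rewrite /interior; apply: filterS (open_nbhs_nbhs (conj oU Ut)) => x Ux.
by move=> /(_ U oU Ux).
Qed.

(** Second countability: the complement of the support is the union of the null balls with rational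
    centre and radius, of which there are countably many. *)
Lemma law_support_full (law : {measure set R -> \bar R}) :
  law (~` law_support law) = 0.
Proof.
pose B (p : rat * rat) : set R := ball (ratr p.1 : R) (ratr p.2).
pose A : set (rat * rat) := [set p | law (B p) = 0].
have -> : ~` law_support law = \bigcup_(p in A) B p.
  apply/seteqP; split => t.
    move=> /existsNP[U /not_implyP[oU /not_implyP[Ut lawU]]].
    have [c [r [/set_mem tB BU]]] := open_subball_rat oU (mem_set Ut).
    exists (c, r) => //; rewrite /A /B /=; apply/eqP.
    rewrite eq_le measure_ge0 andbT.
    apply: le_trans (_ : law U <= 0); last by rewrite leNgt; exact/negP.
    apply: le_measure => //; rewrite inE; first exact: measurable_ball.
    exact: open_measurable.
  move=> [p Ap Bt] /(_ (B p) (ball_open _ _) Bt).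
  by rewrite Ap ltxx.
(* [C] enumerates the null rational balls, with the empty set at every other code. *)
pose C n : set R := if unpickle n is Some p then (if law (B p) == 0 then B p else set0)
  else set0.
apply: measure_negligible.
  by apply: open_measurable; apply: bigcup_open => p _; exact: ball_open.
have CE p : law (B p) = 0 -> C (pickle p) = B p.
  by move=> Bp0; rewrite /C pickleK Bp0 eqxx.
have negC n : law.-negligible (C n).
  rewrite /C; case: (unpickle n) => [p|]; last exact: negligible_set0.
  case: ifPn => [/eqP Bp0|_]; last exact: negligible_set0.
  by apply/(negligibleP law (measurable_ball _ _)).
apply: negligibleS (negligible_bigcup negC) => t [p Ap Bt].
by exists (pickle p); [exact: I|rewrite CE].
Qed.

End null_sets.

(** * Regression functions *)

Section regression.
Context {R : realType} {d : measure_display} {T : measurableType d}.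
Variable P : probability T R.

(** Applied with [m] an integer part, this writes it as a sum of threshold indicators. *)
Let sum_ltn (k m : nat) : (m <= k)%N -> \sum_(i < k) (i < m)%N%:R = m%:R :> R.
Proof.
move=> mk; rewrite -[in LHS](subnKC mk) big_split_ord /=.
rewrite (eq_bigr (fun=> 1)); last by move=> i _; rewrite ltn_ord.
rewrite [X in _ + X]big1 ?addr0; first by rewrite sumr_const card_ord.
by move=> i _; rewrite ltnNge leq_addr.
Qed.

(* [N * (psi + C)] is within 1 of a sum of indicators of superlevel sets of
   [psi]; dividing by [N] extends orthogonality from indicators to [psi]. *)
Lemma orthogonal_indic_bounded (s xi : T -> R) (psi : R -> R) :
  measurable_fun setT s -> bounded_measurable xi -> bounded_measurable psi ->
  (forall B, measurable B -> \int[P]_x (\1_B (s x) * xi x) = 0) ->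
  \int[P]_x (psi (s x) * xi x) = 0.
Proof.
move=> ms bxi [mpsi [C psiC]] H.
have [_ [D xiD]] := bxi.
have Exi : \int[P]_x xi x = 0.
  rewrite -[RHS](H setT measurableT); apply: eq_Rintegral => x _.
  by rewrite indicT mul1r.
have bpsi : bounded_measurable psi by split => //; exists C.
have C0 : 0 <= C := le_trans (normr_ge0 _) (psiC 0).
(* The shift makes the function nonnegative, as the integer part requires; it costs nothing because
   [xi] has mean 0. *)
pose g t := psi t + C.
have g0 t : 0 <= g t by have := psiC t; rewrite ler_norml /g; lra.
have gC t : g t <= 2 * C by have := psiC t; rewrite ler_norml /g; lra.
have bg : bounded_measurable g.
  by apply: bounded_measurableD => //; exact: bounded_measurable_cst.
have bgs : bounded_measurable (g \o s) by exact: bounded_measurable_comp.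
have bgx : bounded_measurable (fun x => g (s x) * xi x).
  exact: (bounded_measurableM bgs).
suff Eg : \int[P]_x (g (s x) * xi x) = 0.
  have -> : \int[P]_x (psi (s x) * xi x) =
      \int[P]_x (g (s x) * xi x - C * xi x).
    by apply: eq_Rintegral => x _; rewrite /g; ring.
  rewrite RintegralB//; first by rewrite Eg RintegralZl ?Exi ?mulr0 ?subr0//;
    exact: bounded_measurable_integrable.
    exact: bounded_measurable_integrable.
  apply: bounded_measurable_integrable; apply: bounded_measurableM => //.
  exact: bounded_measurable_cst.
have bound (N : nat) : N%:R * `|\int[P]_x (g (s x) * xi x)| <= D.
  pose K := (Num.truncn (N%:R * (2 * C))).+1.
  (* Thresholds start at 1, so that exactly [truncn (N * g t)] of them are reached; [K] of them
     suffice because [g <= 2 * C]. *)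
  pose A (k : nat) : set R := [set t | k.+1%:R <= N%:R * g t].
  have mA k : measurable (A k).
    rewrite -[A k]setTI; have := @measurable_fun_ler _ _ R setT (fun=> k.+1%:R)
      (fun t => N%:R * g t).
    move=> /(_ (measurable_cst _)) /(_ (measurable_funM (measurable_cst _) bg.1)).
    by move=> /(_ measurableT [set true] I).
  pose G t : R := \sum_(k < K) \1_(A k) t.
  have GN t : `|N%:R * g t - G t| <= 1.
    have Ng0 : 0 <= N%:R * g t by rewrite mulr_ge0.
    have -> : G t = (Num.truncn (N%:R * g t))%:R.
      rewrite -(@sum_ltn K).
        apply: eq_bigr => k _; rewrite indicE truncn_ge_nat//.
        by congr (nat_of_bool _)%:R; apply/idP/idP; rewrite inE.
      by apply: leqW; apply: le_truncn; rewrite ler_wpM2l.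
    have := truncn_itv Ng0; rewrite -natr1 ler_norml => /andP[? ?].
    by apply/andP; split; lra.
  have b1 k : bounded_measurable (fun x => \1_(A k) (s x) * xi x).
    apply: bounded_measurableM => //.
    apply: (@bounded_measurable_comp _ _ _ _ _ (\1_(A k))) => //.
    split; first exact: measurable_indic.
    by exists 1 => x; rewrite indicE; case: (x \in _); rewrite /= ?normr1 ?normr0.
  have bG : bounded_measurable (fun x => G (s x) * xi x).
    rewrite [X in bounded_measurable X](_ : _ =
        (fun x => \sum_(k < K) \1_(A k) (s x) * xi x)).
      exact: (@bounded_measurable_sum _ _ _ K (fun k x => \1_(A k) (s x) * xi x)).
    by apply/funext => x; rewrite /G mulr_suml.
  have EG : \int[P]_x (G (s x) * xi x) = 0.
    rewrite [LHS](_ : _ = \int[P]_x (\sum_(k < K) \1_(A k) (s x) * xi x)).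
      rewrite (Rintegral_sum P K b1) big1// => k _; exact: H.
    by apply: eq_Rintegral => x _; rewrite /G mulr_suml.
  have bNg : bounded_measurable (fun x => N%:R * (g (s x) * xi x)).
    by apply: bounded_measurableM => //; exact: bounded_measurable_cst.
  have bNgG : bounded_measurable (fun x => N%:R * (g (s x) * xi x) - G (s x) * xi x).
    exact: bounded_measurableB.
  have -> : N%:R * `|\int[P]_x (g (s x) * xi x)| =
      `|\int[P]_x (N%:R * (g (s x) * xi x) - G (s x) * xi x)|.
    rewrite RintegralB//; [|exact: bounded_measurable_integrable..].
    rewrite EG subr0 RintegralZl//; last exact: bounded_measurable_integrable.
    by rewrite normrM normr_nat.
  apply: (le_trans (le_normr_Rintegral _ _)) => //.
    exact: bounded_measurable_integrable.
  apply: Rintegral_le_cst.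
    exact: bounded_measurable_norm.
  move=> x; rewrite mulrA -mulrBl normrM -[leRHS]mul1r ler_pM//.
(* A nonzero integral would violate the bound for some [N] beyond [D / I]. *)
apply/eqP; rewrite -normr_le0 leNgt; apply/negP => I0.
set I := `|_| in I0 bound.
have D0 : 0 <= D by apply: le_trans (normr_ge0 _) (xiD point).
have := truncnS_gt (D / I); rewrite ltr_pdivrMr// => DI.
by have := bound (Num.truncn (D / I)).+1; rewrite leNgt DI.
Qed.

(** A nonnegative function of integral zero vanishes almost everywhere, which strict positivity on
    [A] permits only if [A] is null. *)
Lemma measure0_of_integral_gt0 (f : T -> R) (A : set T) : measurable A ->
  P.-integrable setT (EFin \o f) -> (forall x, A x -> 0 < f x) ->
  (\int[P]_(x in A) (f x)%:E = 0)%E -> P A = 0%E.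
Proof.
move=> mA intf f0 If.
have mf : measurable_fun A (EFin \o f).
  by apply: measurable_funTS; case/integrableP: intf.
have := (ae_eq_integral_abs P mA mf).1.
rewrite (_ : (\int[P]_(x in A) _ = 0)%E); last first.
  rewrite -[RHS]If; apply: eq_integral => x; rewrite inE => Ax /=.
  by rewrite ger0_norm// ltW// f0.
move=> /(_ erefl)[N [mN N0 AN]].
apply/negligibleP => //; exists N; split => //.
apply: subset_trans AN => x Ax /= /(_ Ax) [fx0].
by have := f0 _ Ax; rewrite fx0 ltxx.
Qed.

Variables (r s : T -> R) (m : R -> R).
Hypothesis mr : measurable_fun setT r.
Hypothesis ms : measurable_fun setT s.
Hypothesis r01 : forall x, 0 <= r x <= 1.
Hypothesis reg : is_regression P r s m.

(** The defining identity is tested where [m > 1] and where [m < 0]: on each set the difference of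
    [m (s x)] and [r x] has a strict sign and integral zero. *)
Lemma regression01 : P [set x | ~ (0 <= m (s x) <= 1)] = 0%E.
Proof.
have [mm im Em] := reg.
have br : bounded_measurable r.
  by split => //; exists 1 => x; rewrite ger0_norm; case/andP: (r01 x).
have ir := bounded_measurable_integrable P br.
have mms : measurable_fun setT (m \o s) by exact: measurableT_comp.
have mI (B : set R) : measurable B -> measurable (s @^-1` B).
  by move=> mB; rewrite -[X in measurable X]setTI; exact: ms.
have mIm (B : set R) : measurable B -> measurable (m @^-1` B).
  by move=> mB; rewrite -[X in measurable X]setTI; exact: mm.
have iS (A : set T) f : measurable A -> P.-integrable setT (EFin \o f) ->
    P.-integrable A (EFin \o f).
  by move=> mA; exact: integrableS.
have E0 (B : set R) : measurable B ->
    (\int[P]_(x in s @^-1` B) (m (s x) - r x)%:E = 0 /\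
     \int[P]_(x in s @^-1` B) (r x - m (s x))%:E = 0)%E.
  move=> mB; have mA := mI _ mB.
  have fin : (\int[P]_(x in s @^-1` B) (r x)%:E)%E \is a fin_num.
    by apply: integrable_fin_num => //; exact: iS.
  have i1 : P.-integrable (s @^-1` B) (EFin \o (m \o s)) by exact: iS.
  have i2 : P.-integrable (s @^-1` B) (EFin \o r) by exact: iS.
  have := integralB_EFin mA i1 i2; rewrite /= => ->.
  have := integralB_EFin mA i2 i1; rewrite /= => ->.
  by rewrite Em// subee.
have up : P (s @^-1` (m @^-1` `]1, +oo[)) = 0%E.
  have mB : measurable (m @^-1` `]1, +oo[) by exact: mIm.
  apply: (measure0_of_integral_gt0 (mI _ mB) _ _ (E0 _ mB).1).
    exact: integrableB im ir.
  move=> x /=; rewrite in_itv/= andbT subr_gt0; apply: le_lt_trans.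
  by case/andP: (r01 x).
have dn : P (s @^-1` (m @^-1` `]-oo, 0[)) = 0%E.
  have mB : measurable (m @^-1` `]-oo, 0[) by exact: mIm.
  apply: (measure0_of_integral_gt0 (mI _ mB) _ _ (E0 _ mB).2).
    exact: integrableB ir im.
  move=> x /=; rewrite in_itv/= subr_gt0 => /lt_le_trans; apply.
  by case/andP: (r01 x).
have -> : [set x | ~ (0 <= m (s x) <= 1)] =
    s @^-1` (m @^-1` `]1, +oo[) `|` s @^-1` (m @^-1` `]-oo, 0[).
  apply/seteqP; split => x /=; rewrite !in_itv/= andbT.
    move/negP; rewrite negb_and -!ltNge => /orP[]; [by right|by left].
  by case=> h; apply/negP; rewrite negb_and -!ltNge h ?orbT.
have mup : measurable (s @^-1` (m @^-1` `]1, +oo[)).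
  by apply: mI; apply: mIm; exact: measurable_itv.
have mdn : measurable (s @^-1` (m @^-1` `]-oo, 0[)).
  by apply: mI; apply: mIm; exact: measurable_itv.
apply: measure_negligible; first exact: measurableU.
by apply: negligibleU; apply/negligibleP.
Qed.

(** For indicators this is the definition of a regression function, with [M] in place of [m] because
    they agree off [N]; the preceding approximation extends it to [psi]. *)
Lemma regression_orthogonal (N : set T) (M psi : R -> R) :
  measurable N -> P N = 0%E -> measurable_fun setT M ->
  (forall t, 0 <= M t <= 1) -> (forall x, ~ N x -> M (s x) = m (s x)) ->
  bounded_measurable psi -> \int[P]_x (psi (s x) * (r x - M (s x))) = 0.
Proof.
move=> mN N0 mM M01 Mm bpsi; have [mm im Em] := reg.
have br : bounded_measurable r.
  by split => //; exists 1 => x; rewrite ger0_norm; case/andP: (r01 x).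
have bM : bounded_measurable (M \o s).
  split; first exact: measurableT_comp.
  by exists 1 => x; rewrite ger0_norm; case/andP: (M01 (s x)).
have bxi : bounded_measurable (fun x => r x - M (s x)).
  exact: bounded_measurableB br bM.
apply: orthogonal_indic_bounded => // B mB.
have mA : measurable (s @^-1` B).
  by rewrite -[X in measurable X]setTI; exact: ms.
transitivity (\int[P]_(x in s @^-1` B) (r x - M (s x))).
  rewrite [RHS]Rintegral_mkcond; apply: eq_Rintegral => x _.
  rewrite patchE indicE.
  have -> : (s x \in B) = (x \in s @^-1` B) by apply/idP/idP; rewrite !inE.
  by case: ifPn => _; rewrite ?mul1r ?mul0r.
rewrite /Rintegral.
have iS f : bounded_measurable f -> P.-integrable (s @^-1` B) (EFin \o f).
  by move=> bf; apply: integrableS (bounded_measurable_integrable P bf).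
rewrite integralB_EFin//; [|exact: iS|exact: iS].
have -> : (\int[P]_(x in s @^-1` B) (M (s x))%:E =
    \int[P]_(x in s @^-1` B) (m (s x))%:E)%E.
  apply: ae_eq_integral => //.
  - by apply: measurable_funTS; apply/measurable_EFinP; case: bM.
  - by apply: measurable_funTS; case/integrableP: im.
  - exists N; split => // x /= /not_implyP[_] h; apply: contrapT => /Mm Mmx.
    by apply: h; rewrite Mmx.
by rewrite Em// subee//; apply: integrable_fin_num => //; exact: iS.
Qed.

End regression.

(** * Second moments *)

(** [L] is monotone only on the half-line; precomposed with [Num.max 0] it is monotone everywhere,
    hence measurable. *)
Lemma measurable_radial_kernel {R : realType} (K L : R -> R) :
  (forall x, K x = L `|x|) ->
  (forall x y, 0 <= x -> x <= y -> L y <= L x) -> measurable_fun setT K.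
Proof.
move=> KL Lni.
have -> : K = (fun t => L (Num.max 0 t)) \o Num.norm.
  by apply/funext => x; rewrite KL /= max_r.
apply: measurableT_comp; last exact: normr_measurable.
apply: nonincreasing_measurable => // x y xy.
apply: Lni; first by rewrite le_max lexx.
by rewrite ge_max !le_max lexx xy orbT.
Qed.

Section iid_second_moments.
Context {R : realType} {dO dT : measure_display} {Omega : measurableType dO}
  {T : measurableType dT}.
Variables (P : probability Omega R) (XY : probability T R).
Variable Z : nat -> {RV P >-> T}.
Hypothesis Z_iid : iid XY Z.

(** The pair [(Z i, Z l)] is fixed and the independent [Z j] integrated out. The indices [i] and [l]
    may coincide. *)
Lemma iid_orthogonal (i j l : nat) (F : T * (T * T) -> R) :
  bounded_measurable F -> (forall yz, \int[XY]_x F (x, yz) = 0) ->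
  j != i -> j != l ->
  \int[P]_w F (Z j w, (Z i w, Z l w)) = 0.
Proof.
move=> bF F0 ji jl; have [dZ indep] := Z_iid.
have mil : measurable_fun setT (fun w => (Z i w, Z l w)).
  by apply: measurable_fun_pair; exact: measurable_funPT.
pose W : {mfun Omega >-> (T * T)%type} :=
  HB.pack (fun w => (Z i w, Z l w)) (isMeasurableFun.Build _ _ _ _ _ mil).
apply: (@Rintegral_independent_eq0 _ _ _ _ _ P _ _ (Z j) W) => //.
  by move=> A B mA mB; exact: (independent_pair indep).
move=> yz; rewrite -[RHS](F0 yz); congr fine.
by apply: eq_measure_integral => A mA _; exact: dZ.
Qed.

Lemma iid_sum_sqr (V : T -> R) (C : R) (n : nat) : bounded_measurable V ->
  (forall x, `|V x| <= C) -> \int[XY]_x V x = 0 ->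
  \int[P]_w ((\sum_(i < n) V (Z i w)) ^+ 2) <= n%:R * C ^+ 2.
Proof.
move=> bV VC V0.
apply: (@Rintegral_sqr_sum_orthogonal _ _ _ P n (fun i w => V (Z i w))) => //.
  by move=> i; apply: (bounded_measurable_comp bV); exact: measurable_funPT.
move=> i j ij.
(* The second factor is read off the repeated pair [(Z j, Z j)]. *)
apply: (@iid_orthogonal j i j (fun x => V x.1 * V x.2.1)) => //.
  apply: bounded_measurableM.
    exact: (bounded_measurable_comp bV).
  apply: (@bounded_measurable_comp _ _ _ _ _ V (fun x : T * (T * T) => x.2.1)) => //.
  exact: (measurableT_comp measurable_fst measurable_snd).
move=> yz /=; rewrite RintegralZr ?V0 ?mul0r//.
exact: bounded_measurable_integrable.
Qed.

Variables (s r : T -> R) (M : R -> R).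
Hypothesis ms : measurable_fun setT s.
Hypothesis mr : measurable_fun setT r.
Hypothesis mM : measurable_fun setT M.
Hypothesis r01 : forall x, 0 <= r x <= 1.
Hypothesis M01 : forall t, 0 <= M t <= 1.
Hypothesis orth : forall psi, bounded_measurable psi ->
  \int[XY]_x (psi (s x) * (r x - M (s x))) = 0.
Variables (K : R -> R) (B : R).
Hypothesis mK : measurable_fun setT K.
Hypothesis KB : forall x, 0 <= K x <= B.

Let bK (f : R -> R) : measurable_fun setT f -> bounded_measurable (K \o f).
Proof.
move=> mf; split; first exact: measurableT_comp.
by exists B => x; rewrite ger0_norm; case/andP: (KB (f x)).
Qed.

Let bxi : bounded_measurable (fun x => r x - M (s x)).
Proof.
split; first by apply: measurable_funB => //; exact: measurableT_comp.
exists 1 => x; have := r01 x; have := M01 (s x).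
by rewrite ler_norml => /andP[? ?] /andP[? ?]; apply/andP; split; lra.
Qed.

Lemma bounded_measurable_kweight sigma (i j : nat) :
  bounded_measurable (fun w => kweight K sigma (fun k => s (Z k w)) i j).
Proof.
split; last first.
  exists B => w; rewrite /kweight.
  by rewrite ger0_norm; case/andP: (KB ((s (Z i w) - s (Z j w)) / sigma)).
apply: measurableT_comp => //; apply: measurable_funM => //.
by apply: measurable_funB; apply: measurableT_comp => //; exact: measurable_funPT.
Qed.

Lemma bounded_measurable_kdeviation sigma n (i : nat) :
  bounded_measurable (fun w => kdeviation K sigma n (fun k => s (Z k w))
    (fun k => r (Z k w)) M i).
Proof.
apply: (@bounded_measurable_sum _ _ _ n (fun j w =>
  kweight K sigma (fun k => s (Z k w)) i j * (r (Z j w) - M (s (Z j w))))) => j.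
apply: bounded_measurableM; first exact: bounded_measurable_kweight.
by apply: (bounded_measurable_comp bxi); exact: measurable_funPT.
Qed.

(** For [j] distinct from [i] and [l], the residual of sample [j] is multiplied by a function of
    [s (Z j)] and of samples [i] and [l]. With these two fixed, [orth] makes the integral vanish. *)
Lemma kdeviation_second_moment (sigma : R) (n i : nat) :
  \int[P]_w (kdeviation K sigma n (fun k => s (Z k w)) (fun k => r (Z k w)) M i ^+ 2)
  <= n%:R * B ^+ 2.
Proof.
pose F j w := kweight K sigma (fun k => s (Z k w)) i j * (r (Z j w) - M (s (Z j w))).
have bF j : bounded_measurable (F j).
  apply: bounded_measurableM; first exact: bounded_measurable_kweight.
  by apply: (bounded_measurable_comp bxi); exact: measurable_funPT.
have FB j w : `|F j w| <= B.
  rewrite normrM -[leRHS]mulr1 ler_pM//.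
    by rewrite /kweight ger0_norm; case/andP: (KB ((s (Z i w) - s (Z j w)) / sigma)).
  have := r01 (Z j w); have := M01 (s (Z j w)).
  by rewrite ler_norml => /andP[? ?] /andP[? ?]; apply/andP; split; lra.
suff cross j l : j != i -> j != l -> \int[P]_w (F j w * F l w) = 0.
  apply: (@Rintegral_sqr_sum_orthogonal _ _ _ P n F) => // j l jl.
  (* Two distinct indices cannot both equal [i]; if [j] does, it exchanges roles with [l]. *)
  have [ji|ji] := eqVneq (j : nat) i; last exact: cross.
  rewrite -(@cross l j); last 2 first.
  - by rewrite -ji eq_sym.
  - by rewrite eq_sym.
  by apply: eq_Rintegral => w _; rewrite mulrC.
move=> ji jl.
pose k (x y : T) := K ((s x - s y) / sigma).
pose xi x := r x - M (s x).
apply: (@iid_orthogonal i j l (fun x => (k x.2.1 x.1 * xi x.1) *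
  (k x.2.1 x.2.2 * xi x.2.2))) => //.
- have m1 : measurable_fun setT (fun x : T * (T * T) => x.2.1).
    exact: (measurableT_comp measurable_fst measurable_snd).
  have m2 : measurable_fun setT (fun x : T * (T * T) => x.2.2).
    exact: (measurableT_comp measurable_snd measurable_snd).
  have bk (f g : T * (T * T) -> T) : measurable_fun setT f ->
      measurable_fun setT g -> bounded_measurable (fun x => k (f x) (g x)).
    move=> mf mg; split.
      apply: measurableT_comp => //; apply: measurable_funM => //.
      by apply: measurable_funB; exact: measurableT_comp.
    exists B => x; rewrite /k.
    by rewrite ger0_norm; case/andP: (KB ((s (f x) - s (g x)) / sigma)).
  apply: bounded_measurableM; apply: bounded_measurableM.
  + exact: bk.
  + exact: (bounded_measurable_comp bxi).
  + exact: bk.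
  + exact: (bounded_measurable_comp bxi m2).
- move=> [y z] /=.
  have bpsi : bounded_measurable (fun t : R => K ((s y - t) / sigma) * (k y z * xi z)).
    apply: bounded_measurableM; last exact: bounded_measurable_cst.
    apply: (bK (f := fun t : R => (s y - t) / sigma)).
    by apply: measurable_funM => //; exact: measurable_funB.
  rewrite -[RHS](orth bpsi); apply: eq_Rintegral => x _.
  by rewrite /k /xi; ring.
Qed.

End iid_second_moments.

(** * Consistency of the plugin estimator *)

(** Once [n] is at least [expR 1], its logarithm is at least 1, so dropping the logarithm only
    enlarges the quantity. *)
Lemma cvg_inv_of_rate {R : realType} (sigma : nat -> R) :
  n%:R * sigma n ^+ 2 / ln (n%:R) @[n --> \oo] --> +oo ->
  (n%:R * sigma n ^+ 2)^-1 @[n --> \oo] --> (0 : R).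
Proof.
move=> rate; apply/cvgrPdist_le => e e0.
have /cvgryPge/(_ e^-1) H := rate.
have /cvgryPge/(_ (expR 1)) Hn := @cvgr_idn R.
near=> n.
have ne : expR 1 <= n%:R :> R by near: n.
have ln1 : 1 <= ln (n%:R : R).
  by rewrite -[leLHS](@expRK R) ler_ln ?posrE ?expR_gt0// (lt_le_trans _ ne) ?expR_gt0.
have : e^-1 <= n%:R * sigma n ^+ 2 / ln n%:R by near: n.
rewrite ler_pdivlMr ?(lt_le_trans ltr01)// => Hs.
have es : e^-1 <= n%:R * sigma n ^+ 2.
  by apply: le_trans Hs; rewrite ler_peMr// invr_ge0 ltW.
have s0 : 0 < n%:R * sigma n ^+ 2 by apply: lt_le_trans es; rewrite invr_gt0.
by rewrite sub0r normrN gtr0_norm ?invr_gt0// -[leRHS]invrK lef_pV2// posrE invr_gt0.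
Unshelve. all: end_near. Qed.

Section plugin_consistency.
Context {R : realType} {dO dT : measure_display} {Omega : measurableType dO}
  {T : measurableType dT}.
Variables (P : probability Omega R) (XY : probability T R).
Variable Z : nat -> {RV P >-> T}.
Hypothesis Z_iid : iid XY Z.
Variables (s r : T -> R) (M : R -> R).
Hypothesis ms : measurable_fun setT s.
Hypothesis mr : measurable_fun setT r.
Hypothesis s01 : forall x, 0 <= s x <= 1.
Hypothesis r01 : forall x, 0 <= r x <= 1.
Hypothesis cM : continuous M.
Hypothesis M01 : forall t, 0 <= M t <= 1.
Hypothesis orth : forall psi, bounded_measurable psi ->
  \int[XY]_x (psi (s x) * (r x - M (s x))) = 0.
Variables (K L : R -> R) (B u : R).
Hypothesis K_bound : forall x, 0 <= K x <= B.
Hypothesis K_radial : forall x, K x = L `|x|.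
Hypothesis L_noninc : forall x y, 0 <= x -> x <= y -> L y <= L x.
Hypothesis L_decay : x * L x @[x --> +oo] --> (0 : R).
Hypothesis u_gt0 : 0 < u.
Hypothesis Lu_gt0 : 0 < L u.
Variable sigma : nat -> R.
Hypothesis sigma_gt0 : forall n, 0 < sigma n.
Hypothesis sigma_cvg0 : sigma @ \oo --> (0 : R).
Hypothesis sigma_rate : n%:R * sigma n ^+ 2 / ln (n%:R) @[n --> \oo] --> +oo.
Variables phi dphi : R -> R.
Hypothesis cphi : continuous phi.
Hypothesis cdphi : continuous dphi.

Definition plugin_mean n w := n%:R^-1 * \sum_(i < n)
  (phi (nadaraya_watson K (sigma n) n
          (fun k => s (Z k w)) (fun k => r (Z k w)) (s (Z i w)))
   - phi (s (Z i w)) - dphi (s (Z i w)) * (r (Z i w) - s (Z i w))).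

(** The linear term keeps [r x], as in the estimator; by [orth] the mean is that of the Bregman
    divergence, which has [M (s x)] instead. *)
Definition target x := phi (M (s x)) - phi (s x) - dphi (s x) * (r x - s x).

Let mM : measurable_fun setT M.
Proof. exact: continuous_measurable_fun. Qed.

Let mphi : measurable_fun setT phi.
Proof. exact: continuous_measurable_fun. Qed.

Let mK : measurable_fun setT K.
Proof. exact: measurable_radial_kernel K_radial L_noninc. Qed.

Let bounded_measurable01 (f : R -> R) (g : T -> R) : continuous f ->
  measurable_fun setT g -> (forall x, 0 <= g x <= 1) ->
  bounded_measurable (fun x => f (g x)).
Proof.
move=> cf mg g01; have [C C0 fC] := continuous_bounded01 cf.
split; last by exists C => x; exact: fC.
apply: measurableT_comp => //; exact: continuous_measurable_fun.
Qed.

Lemma bounded_measurable_target : bounded_measurable target.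
Proof.
have bs : bounded_measurable s.
  by split => //; exists 1 => x; rewrite ger0_norm; case/andP: (s01 x).
have br : bounded_measurable r.
  by split => //; exists 1 => x; rewrite ger0_norm; case/andP: (r01 x).
apply: bounded_measurableB.
  apply: bounded_measurableB; last exact: bounded_measurable01.
  apply: (@bounded_measurable01 phi (M \o s) cphi); last by move=> x; exact: M01.
  exact: measurableT_comp.
apply: bounded_measurableM; first exact: bounded_measurable01.
exact: bounded_measurableB.
Qed.

Lemma measurable_plugin_mean n : measurable_fun setT (plugin_mean n).
Proof.
pose ss w k := s (Z k w); pose rr w k := r (Z k w).
have mZ (f : T -> R) k : measurable_fun setT f ->
    measurable_fun setT (fun w => f (Z k w)).
  by move=> mf; apply: measurableT_comp => //; exact: measurable_funPT.
have mW i j : measurable_fun setT (fun w => kweight K (sigma n) (ss w) i j).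
  exact: (bounded_measurable_kweight Z ms mK K_bound (sigma n) i j).1.
have mNW (i : 'I_n) : measurable_fun setT
    (fun w => nadaraya_watson K (sigma n) n (ss w) (rr w) (ss w i)).
  (* The kernel mass is positive, so its inverse can be written with [expR] and [ln], which are
     measurable. *)
  have -> : (fun w => nadaraya_watson K (sigma n) n (ss w) (rr w) (ss w i)) =
      (fun w => (\sum_(j < n) kweight K (sigma n) (ss w) i j * rr w j) *
         expR (- ln (kmass K (sigma n) n (ss w) i))).
    apply/funext => w; rewrite nadaraya_watsonE// expRN lnK// posrE.
        exact: (kmass_gt0 _ K_bound K_radial L_noninc u_gt0 Lu_gt0).
  apply: measurable_funM.
    apply: (@measurable_sum _ _ _ setT _ _ (fun (j : 'I_n) w =>
      kweight K (sigma n) (ss w) i j * rr w j)) => j.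
    by apply: measurable_funM => //; exact: mZ.
  apply: measurableT_comp; first exact: measurable_expR.
  apply: measurable_funN; apply: measurableT_comp; first exact: measurable_ln.
  by apply: (@measurable_sum _ _ _ setT _ _ (fun (j : 'I_n) w =>
    kweight K (sigma n) (ss w) i j)).
apply: measurable_funM; first exact: measurable_cst.
apply: (@measurable_sum _ _ _ setT _ _ (fun (i : 'I_n) w =>
  phi (nadaraya_watson K (sigma n) n (ss w) (rr w) (ss w i))
   - phi (s (Z i w)) - dphi (s (Z i w)) * (r (Z i w) - s (Z i w)))) => i.
apply: measurable_funB.
  apply: measurable_funB; first exact: (measurableT_comp mphi (mNW i)).
  by apply: measurableT_comp => //; exact: mZ.
apply: measurable_funM.
  by apply: measurableT_comp; [exact: continuous_measurable_fun|exact: mZ].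
by apply: measurable_funB; exact: mZ.
Qed.

(** The last deterministic term of [plugin_deviation] at [theta = eta * (n * sigma n)], where the
    factors [n] cancel. *)
Let bias (eta delta : R) n :=
  (eta * sigma n + L (delta / sigma n)) * (((u * sigma n)^-1 + 1) / L u).

(** With [x = delta / sigma n], the term [L x / sigma n] equals [x * L x / delta] and tends to 0;
    the limit comes from [eta * sigma n / (u * sigma n)]. *)
Let bias_cvg eta delta : 0 < delta ->
  bias eta delta n @[n --> \oo] --> eta / u / L u.
Proof.
move=> de0.
have sV : (sigma n)^-1 @[n --> \oo] --> +oo.
  apply/cvgryPge => A.
  have A0 : 0 < (`|A| + 1)^-1 by rewrite invr_gt0 ltr_wpDl.
  apply: filterS (cvgr_lt _ sigma_cvg0 _ A0) => n sA.
  apply: (@le_trans _ _ (`|A| + 1)).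
    by rewrite (le_trans (ler_norm _))// lerDl.
  by rewrite -[leLHS]invrK lef_pV2 ?posrE// ?ltW.
have dsV : delta / sigma n @[n --> \oo] --> +oo.
  apply/cvgryPge => A; move/cvgryPge : sV => /(_ (A / delta)) near.
  by apply: filterS near => n; rewrite ler_pdivrMr// mulrC.
have L0 : (delta / sigma n) * L (delta / sigma n) @[n --> \oo] --> (0 : R).
  exact: (cvg_comp _ _ dsV L_decay).
have -> : bias eta delta = fun n => (eta / u + eta * sigma n +
    delta^-1 * (delta / sigma n * L (delta / sigma n)) * (u^-1 + sigma n)) / L u.
  apply/funext => n; rewrite /bias; field.
  by rewrite !gt_eqF.
have -> : eta / u / L u = (eta / u + eta * 0 + delta^-1 * 0 * (u^-1 + 0)) / L u.
  by rewrite !(mulr0, mul0r, addr0).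
apply: cvgMr_tmp; apply: cvgD.
  by apply: cvgD; [exact: cvg_cst|exact: cvgMl_tmp].
by apply: cvgM; [exact: cvgMl_tmp|apply: cvgD; [exact: cvg_cst|]].
Qed.

(** For large [n] a deviation beyond [eps] forces [Q n w >= eps / 2], and the mean of [Q n] tends to
    0, so Markov's inequality concludes. *)
Lemma cvg_plugin_mean (eps : R) : 0 < eps ->
  (fun n => P [set w | eps < `|plugin_mean n w - \int[XY]_x target x|]) @ \oo
    --> 0%E.
Proof.
move=> eps0; set v := \int[XY]_x target x.
have [C C0 phiC] := continuous_sqr_modulus01 cphi (divr_gt0 eps0 (ltr0n R 8)).
have [delta de0 Mcont] := @continuous_unif01 _ M (eps / (32 * C)) cM
  (divr_gt0 eps0 (mulr_gt0 (ltr0n R 32) C0)).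
(* With this choice [bias] tends to [eps / (32 * C)], half of what [event] tolerates. *)
pose eta := eps * u * L u / (32 * C).
have eta0 : 0 < eta by rewrite divr_gt0 ?mulr_gt0.
have bt := bounded_measurable_target.
pose V x := target x - v.
have bV : bounded_measurable V.
  by apply: bounded_measurableB => //; exact: bounded_measurable_cst.
have [_ [D VD]] := bV.
have EV : \int[XY]_x V x = 0.
  rewrite RintegralB//; [|exact: bounded_measurable_integrable|].
    by rewrite Rintegral_cst// [fine _](congr1 fine (probability_setT XY)) mulr1 subrr.
  exact/bounded_measurable_integrable/bounded_measurable_cst.
pose ss w k := s (Z k w); pose rr w k := r (Z k w).
pose dev n w i := kdeviation K (sigma n) n (ss w) (rr w) M i.
pose theta n := eta * (n%:R * sigma n).
pose Q1 n w := \sum_(i < n) dev n w i ^+ 2.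
pose Q2 n w := (\sum_(i < n) V (Z i w)) ^+ 2.
(* [Q] collects the random terms, with the centred average squared so that second moments
   suffice. *)
pose Q n w := C * (n%:R^-1 * (2 * theta n ^- 2)) * Q1 n w
  + 8 / eps * n%:R^-1 ^+ 2 * Q2 n w.
have bdev n i : bounded_measurable (fun w => dev n w i ^+ 2).
  by apply: bounded_measurableM;
    exact: (bounded_measurable_kdeviation Z ms mr mM r01 M01 mK K_bound).
have bQ1 n : bounded_measurable (Q1 n).
  exact: (@bounded_measurable_sum _ _ _ n (fun i w => dev n w i ^+ 2)).
have bSV n : bounded_measurable (fun w => \sum_(i < n) V (Z i w)).
  apply: (@bounded_measurable_sum _ _ _ n (fun i w => V (Z i w))) => i.
  by apply: (bounded_measurable_comp bV); exact: measurable_funPT.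
have bQ2 n : bounded_measurable (Q2 n) by exact: bounded_measurableM.
have bcM (c : R) f : bounded_measurable f ->
    bounded_measurable (fun w : Omega => c * f w).
  by move=> bf; apply: bounded_measurableM => //; exact: bounded_measurable_cst.
have bQ n : bounded_measurable (Q n) by apply: bounded_measurableD; exact: bcM.
have Q0 n w : 0 <= Q n w.
  apply: addr_ge0; apply: mulr_ge0; rewrite ?sqr_ge0 ?sumr_ge0//.
  - by rewrite !mulr_ge0 ?invr_ge0 ?sqr_ge0 ?(ltW C0).
  - by move=> i _; exact: sqr_ge0.
  - by rewrite !mulr_ge0 ?invr_ge0 ?sqr_ge0 ?(ltW eps0).
have EQ n : (0 < n)%N -> \int[P]_w Q n w <=
    2 * C * B ^+ 2 / eta ^+ 2 * (n%:R * sigma n ^+ 2)^-1 + 8 / eps * D ^+ 2 * n%:R^-1.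
  move=> n0; have nR0 : 0 < n%:R :> R by rewrite ltr0n.
  rewrite RintegralD//; [|exact/bounded_measurable_integrable/bcM..].
  rewrite !RintegralZl//; [|exact: bounded_measurable_integrable..].
  apply: lerD.
    have : \int[P]_w Q1 n w <= n%:R * (n%:R * B ^+ 2).
      rewrite (@Rintegral_sum _ _ _ P n (fun i w => dev n w i ^+ 2))//.
      rewrite mulr_natl -[X in _ *+ X]card_ord -sumr_const; apply: ler_sum => i _.
      exact: (kdeviation_second_moment Z_iid ms mr mM r01 M01 orth mK K_bound).
    move/(ler_wpM2l (_ : 0 <= C * (n%:R^-1 * (2 * theta n ^- 2)))).
    rewrite !mulr_ge0 ?invr_ge0 ?sqr_ge0 ?(ltW C0)// => /(_ isT)/le_trans; apply.
    rewrite le_eqVlt; apply/orP; left; apply/eqP; rewrite /theta; field.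
    by rewrite !gt_eqF.
  have := iid_sum_sqr Z_iid n bV VD EV.
  move/(ler_wpM2l (_ : 0 <= 8 / eps * n%:R^-1 ^+ 2)).
  rewrite !mulr_ge0 ?invr_ge0 ?sqr_ge0 ?(ltW eps0)// => /(_ isT)/le_trans; apply.
  rewrite le_eqVlt; apply/orP; left; apply/eqP; field.
  by rewrite !gt_eqF.
have bias_le : \forall n \near \oo, bias eta delta n <= eps / (16 * C).
  have lim_lt : eta / u / L u < eps / (16 * C).
    have -> : eta / u / L u = eps / (16 * C) / 2.
      by rewrite /eta; field; rewrite !gt_eqF.
    by rewrite ltr_pdivrMr// ltr_pMr ?divr_gt0 ?mulr_gt0// ltr1n.
  have near := cvgr_lt _ (@bias_cvg eta delta de0) _ lim_lt.
  case: near => N _ HN; exists N => // n Nn; exact/ltW/HN.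
have event n w : (0 < n)%N -> bias eta delta n <= eps / (16 * C) ->
    eps < `|plugin_mean n w - v| -> eps / 2 <= Q n w.
  move=> n0 bn; have nR0 : 0 < n%:R :> R by rewrite ltr0n.
  have th0 : 0 < theta n by apply: mulr_gt0 => //; apply: mulr_gt0.
  move=> /lt_le_trans/(_ (plugin_deviation K_bound K_radial L_noninc u_gt0 Lu_gt0
    (sigma_gt0 n) (fun i => s01 (Z i w)) (fun i => r01 (Z i w)) M01 dphi v n0 th0
    de0 (ltW C0) Mcont phiC)).
  have -> : n%:R^-1 * (theta n + n%:R * L (delta / sigma n)) *
      (((u * sigma n)^-1 + 1) / L u) = bias eta delta n.
    by rewrite /theta /bias; congr (_ * _); field; rewrite gt_eqF.
  set W := n%:R^-1 * _; set W' := n%:R^-1 * _ => lt_eps.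
  have QE : Q n w = C * W + 8 / eps * W' ^+ 2.
    have WE : W = n%:R^-1 * (2 / theta n ^+ 2 * Q1 n w) by [].
    have WE' : W' = n%:R^-1 * \sum_(i < n) V (Z i w) by [].
    by rewrite /Q WE WE' /Q2; ring.
  (* The absolute value is traded for a square; completing the square shows the difference to be
     nonnegative. *)
  have W'le : `|W'| <= eps / 8 + 8 / eps * W' ^+ 2.
    rewrite -[W' ^+ 2]real_normK ?num_real//; set a := `|W'|.
    rewrite -subr_ge0
      (_ : _ - _ = 8 / eps * ((a - eps / 16) ^+ 2 + 3 / 256 * eps ^+ 2)).
      apply: mulr_ge0; first by rewrite divr_ge0 ?(ltW eps0).
      by apply: addr_ge0; [exact: sqr_ge0|apply: mulr_ge0; [lra|exact: sqr_ge0]].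
    by field; rewrite gt_eqF.
  have Ce : C * (2 * (eps / (32 * C))) = eps / 16.
    by field; rewrite gt_eqF.
  have Cb : C * (2 * bias eta delta n) <= eps / 8.
    have -> : eps / 8 = C * (2 * (eps / (16 * C))) by field; rewrite gt_eqF.
    by do 2 rewrite ler_pM2l//.
  (* The nonrandom terms add up to [eps / 8 + eps / 16 + eps / 8 + eps / 8], which is less than
     [eps / 2]. *)
  move: lt_eps; rewrite QE !mulrDr Ce.
  by move: W'le Cb; lra.
have mA n : measurable [set w | eps < `|plugin_mean n w - v|].
  have mD : measurable_fun setT (fun w => `|plugin_mean n w - v|).
    apply: measurableT_comp; first exact: normr_measurable.
    by apply: measurable_funB; [exact: measurable_plugin_mean|exact: measurable_cst].
  have := measurable_fun_ltr (measurable_cst eps) mD.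
  by move=> /(_ measurableT [set true] I); rewrite setTI.
pose b n := (eps / 2)^-1 * (2 * C * B ^+ 2 / eta ^+ 2 * (n%:R * sigma n ^+ 2)^-1
  + 8 / eps * D ^+ 2 * n%:R^-1).
have b_cvg : b n @[n --> \oo] --> (0 : R).
  have -> : 0 = (eps / 2)^-1 * (2 * C * B ^+ 2 / eta ^+ 2 * 0 + 8 / eps * D ^+ 2 * 0).
    by rewrite !(mulr0, addr0).
  apply: cvgMl_tmp; apply: cvgD; apply: cvgMl_tmp; first exact: cvg_inv_of_rate.
  apply/cvgrPdist_le => e e0; have /cvgryPge/(_ e^-1)[N _ HN] := @cvgr_idn R.
  exists N => // n /HN /= en; have n0 : 0 < n%:R :> R.
    by apply: lt_le_trans en; rewrite invr_gt0.
  rewrite sub0r normrN gtr0_norm ?invr_gt0// -[leRHS]invrK lef_pV2// posrE.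
  by rewrite invr_gt0.
apply: (squeeze_cvge (f := fun=> 0%E) (h := fun n => (b n)%:E)).
- case: bias_le => N _ HN; exists N.+1 => // n /= Nn.
  have n0 : (0 < n)%N by exact: leq_trans Nn.
  rewrite measure_ge0/=.
  have := @le_measure_markov _ _ _ P (Q n) _ (eps / 2) (bQ n) (Q0 n)
    (divr_gt0 eps0 (ltr0n R 2)) (mA n) (fun w => event n w n0 (HN n (ltnW Nn))).
  move/le_trans; apply; rewrite lee_fin ler_pM2l ?invr_gt0 ?divr_gt0//.
  exact: EQ.
- exact: cvg_cst.
- by apply: cvg_EFin; [exact: nearW|exact: b_cvg].
Qed.

End plugin_consistency.

(** * Continuity of [phi] and measurability through the simplex *)

(** Near [t] the difference quotient is within 1 of its limit [l], so increments of [phi] from [t]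
    are at most [|l| + 1] times the distance. *)
Lemma C1_on01_continuous {R : realType} (phi : R -> \bar R) : C1_on01 phi ->
  {within `[0, 1], continuous (fine \o phi)}.
Proof.
move=> [_ dphi _]; apply/subspace_continuousP => t /= t01.
have /cvg_ex[/= l ql] := dphi _ t01.
apply/cvgrPdist_lt => e e0.
have /cvgrPdist_lt/(_ _ ltr01) := ql.
rewrite !near_withinE => near1.
have l0 : 0 < `|l| + 1 by rewrite ltr_wpDl.
have near2 : \forall s \near t, `|t - s| < e / (`|l| + 1).
  by apply: nbhsx_ballx; rewrite divr_gt0.
near=> s => s01.
have st : `|t - s| < e / (`|l| + 1) by near: s.
have [->|nst] := eqVneq s t; first by rewrite subrr normr0.
have ls : `|l - diff_quotient phi t s| < 1.
  by move: nst s01; near: s.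
have q1 : `|diff_quotient phi t s| <= `|l| + 1.
  have := ler_normB l (l - diff_quotient phi t s); rewrite opprB addrC subrK.
  by move/le_trans; apply; rewrite lerD2l ltW.
have -> : fine (phi t) - fine (phi s) = diff_quotient phi t s * (t - s).
  rewrite /diff_quotient -[t - s]opprB mulrN divfK ?opprB//.
  by rewrite subr_eq0.
rewrite normrM; apply: le_lt_trans (ler_wpM2r (normr_ge0 _) q1) _.
by rewrite mulrC -ltr_pdivlMr.
Unshelve. all: end_near. Qed.

Lemma measurable_simplex {R : realType} (k : nat) : measurable (@simplex R k).
Proof.
have -> : @simplex R k =
    \bigcap_(i : 'I_k) [set p : k.-tuple R | (0 <= tnth p i) = true] `&`
    [set p : k.-tuple R | (\sum_i tnth p i == 1) = true].
  apply/seteqP; split => p.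
    by move=> [p0 p1]; split=> [i _|]; [exact: p0|exact/eqP].
  by move=> [p0 /= /eqP p1]; split=> // i; exact: p0.
have mt (i : 'I_k) : measurable_fun setT (fun p : k.-tuple R => tnth p i).
  exact: measurable_tnth.
apply: measurableI.
  apply: fin_bigcap_measurable => // i _.
  have := measurable_fun_ler (measurable_cst (0 : R)) (mt i).
  by move=> /(_ measurableT [set true] I); rewrite setTI.
have ms : measurable_fun setT (fun p : k.-tuple R => \sum_i tnth p i).
  exact: (@measurable_sum _ _ _ setT _ _ (fun i (p : k.-tuple R) => tnth p i)).
have := measurable_fun_eqr ms (measurable_cst (1 : R)).
by move=> /(_ measurableT [set true] I); rewrite setTI.
Qed.

Section measurable_on_simplex.
Context {R : realType} {d k : nat}.
Variable g : d.-tuple R -> k.+1.-tuple R.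
Hypothesis g_meas : measurable_fun setT g.
Hypothesis g_simplex : forall x, simplex (g x).

(** [f] is measurable on the simplex only; [g] takes its values there, so preimages may be
    intersected with it. *)
Lemma measurable_comp_simplex {d' : measure_display} {T' : measurableType d'}
    (f : k.+1.-tuple R -> T') :
  measurable_fun (@simplex R k.+1) f -> measurable_fun setT (f \o g).
Proof.
move=> mf _ Y mY; rewrite setTI.
have -> : (f \o g) @^-1` Y = g @^-1` (@simplex R k.+1 `&` f @^-1` Y).
  by apply/seteqP; split => x /=; [split|case].
rewrite -[X in measurable X]setTI; apply: g_meas => //.
by apply: mf => //; exact: measurable_simplex.
Qed.

(** The agreement set is a finite union of rectangles, one per label. *)
Lemma measurable_eq_label (c : k.+1.-tuple R -> 'I_k.+1) :
  measurable_fun (@simplex R k.+1) c ->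
  measurable_fun setT
    (fun z : d.-tuple R * 'I_k.+1 => (z.2 == c (g z.1))%:R : R).
Proof.
move=> /measurable_comp_simplex mc.
pose E := [set z : d.-tuple R * 'I_k.+1 | z.2 = c (g z.1)].
have mE : measurable E.
  have -> : E = \bigcup_(i : 'I_k.+1) (((c \o g) @^-1` [set i]) `*` [set i]).
    apply/seteqP; split => [[x y] /= xy|[x y] [i _ [/= <- ->]]//].
    by exists y => //; split.
  apply: fin_bigcup_measurable => // i _; apply: measurableX => //.
  by rewrite -[X in measurable X]setTI; exact: mc.
rewrite [X in measurable_fun _ X](_ : _ = \1_E); first exact: measurable_indic.
apply/funext => z; rewrite indicE; congr (nat_of_bool _)%:R.
by apply/eqP/idP => [|]; rewrite inE.
Qed.

End measurable_on_simplex.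

(** * Reduction to continuous real-valued data *)

Theorem theoremC4 (R : realType) (d k : nat)
  (XY : probability (d.-tuple R * 'I_k.+1)%type R)
  (g : d.-tuple R -> k.+1.-tuple R)
  (g_meas : measurable_fun setT g)
  (g_simplex : forall x, simplex (g x))
  (c : k.+1.-tuple R -> 'I_k.+1)
  (c_meas : measurable_fun (@simplex R k.+1) c)
  (h : k.+1.-tuple R -> R)
  (h_meas : measurable_fun (@simplex R k.+1) h)
  (h01 : forall p, simplex p -> 0 <= h p <= 1)
  (dO : measure_display) (Omega : measurableType dO) (P : probability Omega R)
  (Z : nat -> {RV P >-> (d.-tuple R * 'I_k.+1)%type})
  (Z_iid : iid XY Z)
  (phi : R -> \bar R)
  (phi_C1 : C1_on01 phi)
  (phi_convex : strictly_convex_on01 phi)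
  (K : R -> R)
  (K_kernel : admissible_kernel K)
  (sigma : nat -> R)
  (sigma_gt0 : forall n, 0 < sigma n)
  (sigma_cvg0 : sigma @ \oo --> (0 : R))
  (sigma_rate : n%:R * sigma n ^+ 2 / ln (n%:R) @[n --> \oo] --> +oo)
  (m : R -> R)
  (conf := fun z : d.-tuple R * 'I_k.+1 => h (g z.1))
  (correct := fun z : d.-tuple R * 'I_k.+1 => (z.2 == c (g z.1))%:R : R)
  (m_version : is_regression XY correct conf m)
  (m_cont : {within law_support (pushforward XY conf), continuous m})
  (conf_density : has_density_bounded_away_from_zero (pushforward XY conf)) :
  cvg_in_probability P
    (fun n w => plugin phi K (sigma n) n
                  (fun i => conf (Z i w)) (fun i => correct (Z i w)))
    (\int[XY]_z bregman phi (m (conf z)) (conf z))%E.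
Proof.
have s01 z : 0 <= conf z <= 1 by apply: h01; exact: g_simplex.
have r01 z : 0 <= correct z <= 1.
  by rewrite /correct; case: (_ == _); rewrite /= ?lexx ?ler01.
have ms : measurable_fun setT conf.
  have mhg := measurable_comp_simplex g_meas g_simplex h_meas.
  exact: measurableT_comp mhg measurable_fst.
have mr : measurable_fun setT correct.
  exact: (measurable_eq_label g_meas g_simplex c_meas).
have [phi_fin _ cdphi] := phi_C1.
(* [f] and [df] are continuous on the whole line and agree with [phi] and its derivative on
   [0, 1]. *)
pose f := (fine \o phi) \o clamp01.
pose df := deriv01 phi \o clamp01.
have cf : continuous f.
  exact/clamp01_continuous_within/C1_on01_continuous.
have cdf : continuous df by exact: clamp01_continuous_within.
have phiE t : 0 <= t <= 1 -> phi t = (f t)%:E.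
  by move=> t01; rewrite /f /= clamp01_id// fineK// phi_fin// in_itv.
have derE t : 0 <= t <= 1 -> deriv01 phi t = df t.
  by move=> t01; rewrite /df /= clamp01_id.
have bdf : bounded_measurable df.
  split; first exact: continuous_measurable_fun.
  have [C _ dfC] := continuous_bounded01 cdf; exists C => t.
  have := dfC _ (clamp01_itv t); rewrite /df /= clamp01_id//.
  exact: clamp01_itv.
pose S := law_support (pushforward XY conf).
pose lawc : {measure set R -> \bar R} :=
  (pushforward XY conf : {measure set R -> \bar R}).
have S_null : XY (conf @^-1` (~` S)) = 0%E.
  exact: (law_support_full (lawc ms)).
have closedS : closed S by exact: closed_law_support.
have cm01 : {within S, continuous (clamp01 \o m)}.
  apply/subspace_continuousP => t St.
  have /subspace_continuousP/(_ _ St) mt := m_cont.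
  exact: cvg_comp mt (@continuous_clamp01 R (m t)).
(* Tietze extension from the closed support; [m] is clamped first because the extension needs a
   bounded function. *)
have [M0 [M0E cM0 _]] : exists M0 : R -> R, [/\ {in S, clamp01 \o m =1 M0},
    continuous M0 & forall x, `|M0 x| <= 1].
  apply: continuous_bounded_extension => //.
  - exact: pseudometric_normal.
  - by move=> x _ /=; rewrite ger0_norm; case/andP: (clamp01_itv (m x)).
(* The extension is only known to lie in [-1, 1], so it is clamped again; on the support this
   changes nothing. *)
pose M := clamp01 \o M0.
have cM : continuous M.
  by move=> x; apply: continuous_comp; [exact: cM0|exact: continuous_clamp01].
have M01 t : 0 <= M t <= 1 by exact: clamp01_itv.
have mM : measurable_fun setT M by exact: continuous_measurable_fun.
pose N := conf @^-1` (~` S) `|` [set z | ~ (0 <= m (conf z) <= 1)].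
have mN1 : measurable (conf @^-1` (~` S)).
  rewrite -[X in measurable X]setTI; apply: ms => //.
  by apply: open_measurable; exact: closed_openC.
have mN2 : measurable [set z | ~ (0 <= m (conf z) <= 1)].
  have [mm _ _] := m_version.
  rewrite [X in measurable X](_ : _ = (m \o conf) @^-1` (~` `[0, 1])).
    rewrite -[X in measurable X]setTI; apply: (measurableT_comp mm ms) => //.
    exact: measurableC.
  by apply/seteqP; split => z /=; rewrite in_itv.
have mN : measurable N by exact: measurableU.
have N_null : XY N = 0%E.
  apply: measure_negligible => //; apply: negligibleU; apply/negligibleP => //.
  exact: (regression01 mr ms r01 m_version).
have m01 z : ~ N z -> 0 <= m (conf z) <= 1.
  by move=> Nz; apply: contrapT => mz; apply: Nz; right.
have Mm z : ~ N z -> M (conf z) = m (conf z).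
  move=> Nz; have Sz : conf z \in S.
    by rewrite inE; apply: contrapT => Sz; apply: Nz; left.
  rewrite /M /= -M0E//= clamp01_id ?clamp01_itv// clamp01_id//.
  exact: m01.
have orth psi : bounded_measurable psi ->
    \int[XY]_z (psi (conf z) * (correct z - M (conf z))) = 0.
  exact: (regression_orthogonal mr ms r01 m_version mN N_null mM M01 Mm).
have [[B K_bound] [L [K_radial L_noninc L_decay [u u0 Lu0]]]] := K_kernel.
have := cvg_plugin_mean Z_iid ms mr s01 r01 cM M01 orth K_bound K_radial L_noninc
  L_decay u0 Lu0 sigma_gt0 sigma_cvg0 sigma_rate cf cdf.
have bt := bounded_measurable_target ms mr s01 r01 cM M01 cf cdf.
have int_target : (\int[XY]_z bregman phi (m (conf z)) (conf z) =
    (\int[XY]_z target conf correct M f df z)%:E)%E.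
  pose F z := f (M (conf z)) - f (conf z) - df (conf z) * (M (conf z) - conf z).
  (* On [N] the value [m (conf z)] may leave [0, 1], where [phi] is arbitrary; the integral ignores
     this null set. *)
  rewrite (eq_integral_off_null (g := fun z => (F z)%:E) mN N_null); last first.
    move=> z Nz; rewrite /bregman /F Mm// (phiE _ (m01 _ Nz)) (phiE _ (s01 z)).
    by rewrite derE// !EFinB.
  (* [G] is the difference between the divergence and [target]; its mean is zero by [orth] with
     [psi = df]. *)
  pose G z := df (conf z) * (correct z - M (conf z)).
  have bG : bounded_measurable G.
    apply: bounded_measurableM; first exact: (bounded_measurable_comp bdf).
    apply: bounded_measurableB.
      by split => //; exists 1 => z; rewrite ger0_norm; case/andP: (r01 z).
    split; first exact: measurableT_comp.
    by exists 1 => z; rewrite ger0_norm; case/andP: (M01 (conf z)).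
  have FE : F = fun z => target conf correct M f df z + G z.
    by apply/funext => z; rewrite /F /target /G; ring.
  have bF : bounded_measurable F by rewrite FE; exact: bounded_measurableD.
  rewrite bounded_measurable_EFin// FE RintegralD//; last 2 first.
  - exact: bounded_measurable_integrable.
  - exact: bounded_measurable_integrable.
  by rewrite [X in _ + X]orth// addr0.
(* All arguments of [phi] lie in [0, 1], so the extended real estimator is a real number. *)
have pluginE n w : plugin phi K (sigma n) n (fun i => conf (Z i w))
    (fun i => correct (Z i w)) =
    (plugin_mean Z conf correct K sigma f df n w)%:E.
  rewrite /plugin /plugin_mean EFinM -sumEFin; congr (_ * _)%E.
  apply: eq_bigr => i _.
  have nw01 := nadaraya_watson01 K_bound K_radial L_noninc u0 Lu0 (sigma_gt0 n)
    (fun i => conf (Z i w)) (fun i => r01 (Z i w)) (ltn_ord i).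
  by rewrite (phiE _ nw01) (phiE _ (s01 _)) derE// !EFinB.
move=> core eps eps0; rewrite int_target.
under eq_fun do under eq_set do rewrite pluginE -EFinB abse_EFin lte_fin.
exact: core.
Qed.
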